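(* Consider the RIS-aided MIMO channel $\mathbf G=\sqrt{\beta_{\mathrm t}\beta_{\mathrm r}}\mathbf R\boldsymbol\Phi\mathbf T+\sqrt{\beta_{\mathrm d}}\mathbf H$ described in the context, with $N_{\mathrm t}>N_{\mathrm r}$, and let $C=\mathbb E\{\log_2\det(\mathbf I_{N_{\mathrm r}}+\bar\rho\,\mathbf G\mathbf G^{\dagger})\}$ with $\bar\rho=\rho/N_{\mathrm t}$, $\rho>0$. Then $$C\le\log_2\Big(\sum_{t=0}^{N_{\mathrm r}}\bar\rho^{\,t}\sum_{\mathcal Q\subseteq\{1,\dots,N_{\mathrm t}\},\,|\mathcal Q|=t}\det(\boldsymbol\Psi_{\mathcal Q})\,\mathsf J_{N_{\mathrm r}}\big(\tilde\theta_1,\dots,\tilde\theta_{L_{\mathcal Q}}\big)\frac{(N_{\mathrm r}-L_{\mathcal Q})!}{(N_{\mathrm r}-t)!}\Big),$$ where for each $\mathcal Q$, $\tilde\theta_1,\dots,\tilde\theta_{L_{\mathcal Q}}$ are the non-zero eigenvalues of $\boldsymbol\Psi_{\mathcal Q}^{-1}\boldsymbol\Sigma_{\mathcal Q}$ with $\boldsymbol\Sigma=\bar{\mathbf G}^{\dagger}\bar{\mathbf G}$.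
   Context: Setup: $N_{\mathrm t},N_{\mathrm r},M=M_{\mathrm h}M_{\mathrm v}$ positive integers; $\mathbf T\in\mathbb C^{M\times N_{\mathrm t}}$, $\bar{\mathbf R}\in\mathbb C^{N_{\mathrm r}\times M}$, $\bar{\mathbf H}\in\mathbb C^{N_{\mathrm r}\times N_{\mathrm t}}$ are line-of-sight matrices of the form $\mathbf T=\sum_{i=1}^{P_{\mathbf T}}\frac{t_i}{\sqrt{P_{\mathbf T}}}\mathbf a_{M_{\mathrm h},M_{\mathrm v}}(\varphi_{a_1,i},\theta_{a_1,i})\mathbf a_{N_{\mathrm t}}(\theta_{d_1,i})^\intercal$, $\bar{\mathbf R}=\sum_{i=1}^{P_{\mathbf R}}\frac{r_i}{\sqrt{P_{\mathbf R}}}\mathbf a_{N_{\mathrm r}}(\theta_{a_2,i})\mathbf a_{M_{\mathrm h},M_{\mathrm v}}(\varphi_{d_2,i},\theta_{d_2,i})^\intercal$, $\bar{\mathbf H}=\sum_{i=1}^{P_{\mathbf H}}\frac{h_i}{\sqrt{P_{\mathbf H}}}\mathbf a_{N_{\mathrm r}}(\theta_{a_3,i})\mathbf a_{N_{\mathrm t}}(\theta_{d_3,i})^\intercal$, where $\mathbf a_N(\theta)=[e^{\mathsf j2\pi(n-1)\frac{d}{\lambda}\sin\theta}]_{n=1}^{N}$ (column; $d=d_{\mathrm t}$ for $N_{\mathrm t}$, $d=d_{\mathrm r}$ for $N_{\mathrm r}$) and $\mathbf a_{M_{\mathrm h},M_{\mathrm v}}(\varphi,\theta)^\intercal=[e^{\mathsf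 j2\pi(m-1)\frac{d_{\mathrm v}}{\lambda}\sin\theta}]_{m=1}^{M_{\mathrm v}}\otimes[e^{\mathsf j2\pi(n-1)\frac{d_{\mathrm h}}{\lambda}\cos\theta\sin\varphi}]_{n=1}^{M_{\mathrm h}}$. The gains $t_i,r_i,h_i$ (i.i.d. $\mathcal{CN}(0,1)$ in the model) and all angles are treated as fixed (the result is conditional on them). $\boldsymbol\Phi=\mathrm{diag}\{e^{\mathsf j\theta_1},\dots,e^{\mathsf j\theta_M}\}$ is fixed. $\beta_{\mathrm t},\beta_{\mathrm r},\beta_{\mathrm d}>0$; $L_{\mathbf R}+N_{\mathbf R}=1$, $L_{\mathbf H}+N_{\mathbf H}=1$, all $\ge0$, and $N_{\mathbf H}>0$. $\mathbf R=\sqrt{L_{\mathbf R}}\bar{\mathbf R}+\sqrt{N_{\mathbf R}}\tilde{\mathbf R}$, $\mathbf H=\sqrt{L_{\mathbf H}}\bar{\mathbf H}+\sqrt{N_{\mathbf H}}\tilde{\mathbf H}$ with $\tilde{\mathbf R},\tilde{\mathbf H}$ independent with i.i.d. $\mathcal{CN}(0,1)$ entries; the expectation is over $\tilde{\mathbf R},\tilde{\mathbf H}$. Define $\bar{\mathbf G}=\sqrt{\beta_{\mathrm t}\beta_{\mathrm r}L_{\mathbf R}}\bar{\mathbf R}\boldsymbol\Phi\mathbf T+\sqrt{\beta_{\mathrm d}L_{\mathbf H}}\bar{\mathbf H}$ and $\boldsymbol\Psi=\beta_{\mathrm t}\beta_{\mathrm r}N_{\mathbf R}\mathbf T^{\dagger}\mathbf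 T+\beta_{\mathrm d}N_{\mathbf H}\mathbf I_{N_{\mathrm t}}$. For a square matrix $\mathbf A$ and index set $\mathcal Q$, $\mathbf A_{\mathcal Q}$ is the principal submatrix with rows and columns indexed by $\mathcal Q$ (for $\mathcal Q=\emptyset$ its determinant is $1$). For an integer $q$ and numbers $\theta_1,\dots,\theta_L$: $\mathsf J_q(\theta_1,\dots,\theta_L)=\det(\boldsymbol\Delta)/V(\theta_1,\dots,\theta_L)$, where $\boldsymbol\Delta\in\mathbb C^{L\times L}$ has $(i,j)$ entry $(q-L+j+\theta_i)\theta_i^{j-1}$ and $V(\theta_1,\dots,\theta_L)=\prod_{i<j\le L}(\theta_j-\theta_i)$; $\mathsf J_q=1$ when $L=0$, and when eigenvalues coincide the ratio is understood as its limit. *)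

(* Defs.v *)
From HB Require Import structures.
From mathcomp Require Import all_boot all_order all_algebra.
From mathcomp Require Import all_classical all_reals all_analysis.
From mathcomp.real_closed Require Import complex.

Set Implicit Arguments.
Unset Strict Implicit.
Unset Printing Implicit Defensive.

Import Order.TTheory GRing.Theory Num.Theory.
Import numFieldNormedType.Exports.

Local Open Scope classical_set_scope.
Local Open Scope ring_scope.
Local Open Scope complex_scope.

Section Defs.
Variable R : realType.

Definition cexpj (x : R) : R[i] := (cos x) +i* (sin x).

Definition steer (N : nat) (d lam th : R) : 'cV[R[i]]_N :=
  \col_(n < N) cexpj (2 * pi * n%:R * (d / lam) * sin th).

(* a_{Mh,Mv}(phi,theta) (as a column; the paper's a^T is its transpose):
   [e^{j2pi(m-1)(dv/lam) sin th}]_{m=1..Mv} (Kronecker) [e^{j2pi(n-1)(dh/lam) cos th sin phi}]_{n=1..Mh};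
   Kronecker index (m-1)*Mh + n, i.e. 0-based k = m*Mh + n with m = k %/ Mh, n = k %% Mh. *)
Definition steer2 (Mh Mv : nat) (dh dv lam phi th : R) : 'cV[R[i]]_(Mh * Mv) :=
  \col_(k < Mh * Mv)
    (cexpj (2 * pi * (k %/ Mh)%:R * (dv / lam) * sin th) *
     cexpj (2 * pi * (k %% Mh)%:R * (dh / lam) * cos th * sin phi)).

Definition herm (m n : nat) (A : 'M[R[i]]_(m, n)) : 'M[R[i]]_(n, m) :=
  (map_mx conjc A)^T.

Definition rC (x : R) : R[i] := x%:C.

Definition Tmat (Nt Mh Mv PT : nat) (dt dh dv lam : R)
  (tg : 'I_PT -> R[i]) (phia1 tha1 thd1 : 'I_PT -> R) : 'M[R[i]]_(Mh * Mv, Nt) :=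
  \sum_(i < PT) ((tg i / rC (Num.sqrt PT%:R)) *:
     (steer2 Mh Mv dh dv lam (phia1 i) (tha1 i) *m (steer Nt dt lam (thd1 i))^T)).

Definition Rbarmat (Nr Mh Mv PR : nat) (dr dh dv lam : R)
  (rg : 'I_PR -> R[i]) (tha2 phid2 thd2 : 'I_PR -> R) : 'M[R[i]]_(Nr, Mh * Mv) :=
  \sum_(i < PR) ((rg i / rC (Num.sqrt PR%:R)) *:
     (steer Nr dr lam (tha2 i) *m (steer2 Mh Mv dh dv lam (phid2 i) (thd2 i))^T)).

Definition Hbarmat (Nr Nt PH : nat) (dr dt lam : R)
  (hg : 'I_PH -> R[i]) (tha3 thd3 : 'I_PH -> R) : 'M[R[i]]_(Nr, Nt) :=
  \sum_(i < PH) ((hg i / rC (Num.sqrt PH%:R)) *: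
     (steer Nr dr lam (tha3 i) *m (steer Nt dt lam (thd3 i))^T)).

Definition Phimat (M : nat) (th : 'I_M -> R) : 'M[R[i]]_M :=
  diag_mx (\row_(m < M) cexpj (th m)).

(* Matrix with i.i.d. CN(0,1) entries read from a sequence of i.i.d. N(0,1)
   reals: entry (i,j) = (s_{off+2k} + j s_{off+2k+1})/sqrt 2, k = i*n+j. *)
Definition cgauss_mx (m n off : nat) (s : seq R) : 'M[R[i]]_(m, n) :=
  \matrix_(i < m, j < n)
    (((nth 0 s (off + 2 * (i * n + j))) +i* (nth 0 s (off + 2 * (i * n + j) + 1)))
      * rC (Num.sqrt 2)^-1).

(* Expectation of f(X_1,...,X_n) for X_1..X_n i.i.d. standard normal, written
   as an iterated integral against the N(0,1) law. *)
Fixpoint gauss_expect (n : nat) (f : seq R -> \bar R) : \bar R :=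
  match n with
  | 0 => f [::]
  | n'.+1 => (\int[normal_prob (0:R) 1]_x gauss_expect n' (fun s => f (x :: s)))%E
  end.

Definition log2 (x : R) : R := ln x / ln 2.

Definition psub (n : nat) (A : 'M[R[i]]_n) (Q : {set 'I_n}) : 'M[R[i]]_#|Q| :=
  \matrix_(i < #|Q|, j < #|Q|) A (enum_val i) (enum_val j).

Definition Jraw (q : int) (L : nat) (th : 'rV[R]_L) : R :=
  \det (\matrix_(i < L, j < L)
          (((q - L%:Z + (j.+1)%:Z)%:~R + th 0 i) * th 0 i ^+ j))
  / \prod_(i < L) \prod_(j < L | (i < j)%N) (th 0 j - th 0 i).

Definition distinct_pts (L : nat) : set 'rV[R]_L :=
  [set x | forall i j : 'I_L, i != j -> x 0 i != x 0 j].

(* J_q(theta): det(Delta)/V(theta), understood as its limit when some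
   coordinates coincide (limit taken along points with distinct coordinates). *)
Definition Jlim (q : int) (L : nat) (th : 'rV[R]_L) : R :=
  lim (@Jraw q L @ within (@distinct_pts L) (nbhs th)).

Definition Jseq (q : int) (s : seq R) : R :=
  Jlim q (\row_(i < size s) s`_i).

End Defs.

(* Main.v *)
Require Import Defs.
From HB Require Import structures.
From mathcomp Require Import all_boot all_order all_fingroup all_algebra.
From mathcomp Require Import all_classical all_reals all_analysis.
From mathcomp.real_closed Require Import complex.
From mathcomp Require Import measurable_realfun ring lra zify.

Set Implicit Arguments.
Unset Strict Implicit.
Unset Printing Implicit Defensive.

Import Order.TTheory GRing.Theory Num.Theory.
Import numFieldNormedType.Exports.

Local Open Scope classical_set_scope.
Local Open Scope ring_scope.
Local Open Scope complex_scope.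

(** By Jensen's inequality for [ln] it suffices to compute the mean of
    [det (1 + rhob G G^+) = sum_Q rhob^|Q| det ((G^+ G)_Q)].  By Cauchy-Binet
    each [det ((G^+ G)_Q)] is a sum, over injections of [Q] into the rows of [G],
    of products of entries lying in distinct, hence independent, rows.  Its mean
    therefore only involves the first two moments of the noise, and is the same
    sum with [conj G_ia * G_ib] replaced by [Psi_ab + conj Gbar_ia * Gbar_ib].
    The matrices [conj Gbar_ia * Gbar_ib] have rank one, so the sum over
    injections factors and leaves
    [det Psi_Q * sum_k e_k(theta) (Nr - k)! / (Nr - |Q|)!], where [e_k(theta)]
    are the elementary symmetric functions of the eigenvalues of
    [Psi_Q^-1 Sigma_Q].  On the other side, [det Delta / V] is the determinant of
    a companion matrix with a shifted diagonal, and expands into the same sum. *)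

(** * Determinant expansions *)

(** The matrix expression is never handled as a multiple Gaussian integral. If a function has degree
    at most two in each real noise coordinate separately, a standard normal variable and a fair
    random sign give it the same mean. So [gauss_expect] can be traded for the finite average
    [sign_avg], where linearity and independence are plain algebra, complex values are allowed and
    no integrability question arises. The determinant has this degree because a real coordinate
    enters a single row of [G], and each product in the expansion takes one entry and one conjugate
    entry from each row it uses. This is also why minors of [G^+ G] are expanded rather than minors
    of [G G^+]: entries within a row are correlated through [T], whereas the rows are independent.
    The condition [N_H > 0] gives every [Psi_Q] a positive determinant, hence an inverse, and sets
    [Q] with more than [Nr] elements disappear because they have no injection into the rows. *)

Section DeterminantExpansions.
Variable K : comNzRingType.

Definition mix_rows n (U : {set 'I_n}) (A B : 'M[K]_n) : 'M[K]_n :=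
  \matrix_(i, j) if i \in U then A i j else B i j.

Lemma det_mix_rowsD n (A B : 'M[K]_n) :
  \det (A + B) = \sum_(U : {set 'I_n}) \det (mix_rows U A B).
Proof.
rewrite [LHS]/determinant [RHS]exchange_big /=; apply: eq_bigr => s _.
rewrite -mulr_sumr; congr (_ * _).
under eq_bigr do rewrite mxE.
rewrite bigA_distr; apply: eq_bigr => U _.
by apply: eq_bigr => i _; rewrite mxE.
Qed.

Lemma det_sum_rows n (I : finType) (A : I -> 'M[K]_n) :
  \det (\sum_i A i) = \sum_(f : {ffun 'I_n -> I}) \det (\matrix_(a, b) A (f a) a b).
Proof.
rewrite [LHS]/determinant [RHS]exchange_big /=; apply: eq_bigr => s _.
rewrite -mulr_sumr; congr (_ * _).
under eq_bigr do rewrite summxE.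
rewrite bigA_distr_bigA; apply: eq_bigr => f _.
by apply: eq_bigr => i _; rewrite mxE.
Qed.

Lemma det_scale_rows n (c : 'I_n -> K) (A : 'M[K]_n) :
  \det (\matrix_(i, j) (c i * A i j)) = (\prod_i c i) * \det A.
Proof.
have -> : \matrix_(i, j) (c i * A i j) = diag_mx (\row_i c i) *m A.
  by apply/matrixP=> i j; rewrite mul_diag_mx !mxE.
by rewrite det_mulmx det_diag; congr (_ * _); apply: eq_bigr => i _; rewrite mxE.
Qed.

(** Sylvester's identity, valid without inverses: a block matrix is multiplied by a unitriangular
    one on either side, and the two products have the same determinant. *)
Lemma det_1Dmul_comm m n (A : 'M[K]_(m, n)) (B : 'M[K]_(n, m)) :
  \det (1%:M + A *m B) = \det (1%:M + B *m A).
Proof.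
have E1 : block_mx 1%:M (- A) B 1%:M *m block_mx 1%:M A 0 1%:M
        = block_mx 1%:M 0 B (1%:M + B *m A).
  by rewrite mulmx_block !mulmx1 !mulmx0 !mul1mx !addr0 subrr addrC.
have E2 : block_mx 1%:M A 0 1%:M *m block_mx 1%:M (- A) B 1%:M
        = block_mx (1%:M + A *m B) 0 B 1%:M.
  by rewrite mulmx_block !mulmx1 !mul1mx !mul0mx !add0r addrC [- A + A]addrC subrr addrC.
have := congr1 determinant E1; rewrite det_mulmx det_ublock !det1 !mulr1.
rewrite det_lblock det1 mul1r => <-.
have := congr1 determinant E2; rewrite det_mulmx det_ublock !det1 !mul1r.
by rewrite det_lblock det1 mulr1 => <-.
Qed.

Lemma det_gram m n (Y X : 'M[K]_(m, n)) :
  \det (Y^T *m X) =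
  \sum_(f : {ffun 'I_n -> 'I_m}) (\prod_a Y (f a) a) * \det (rowsub f X).
Proof.
have -> : Y^T *m X = \sum_i \matrix_(a, b) (Y i a * X i b).
  apply/matrixP=> a b; rewrite !mxE summxE.
  by apply: eq_bigr => i _; rewrite !mxE.
rewrite det_sum_rows; apply: eq_bigr => f _.
rewrite -det_scale_rows; congr (\det _).
by apply/matrixP=> a b; rewrite !mxE.
Qed.

Lemma det_rowsub_noninj m n (f : 'I_n -> 'I_m) (X : 'M[K]_(m, n)) :
  ~~ injectiveb f -> \det (rowsub f X) = 0.
Proof.
move=> /injectivePn [a [b ab fab]].
by apply: (determinant_alternate ab) => j; rewrite !mxE fab.
Qed.

(* Cauchy-Binet, with each minor counted once for every ordering of its rows. *)
Lemma Cauchy_Binet_ffun m n (Y X : 'M[K]_(m, n)) :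
  \det (Y^T *m X) *+ n`! =
  \sum_(f : {ffun 'I_n -> 'I_m}) \det (rowsub f Y) * \det (rowsub f X).
Proof.
(* Relabelling the selection [f] by a permutation leaves the sum in [det_gram] unchanged. Adding the
   [n!] relabelled copies produces the signed sum over [s], which is the minor of [Y]. *)
pose F (f : {ffun 'I_n -> 'I_m}) (s : 'S_n) : {ffun 'I_n -> 'I_m} := [ffun a => f (s a)].
have FK s : bijective (F^~ s).
  exists (F^~ (s^-1)%g) => f; apply/ffunP => a; rewrite !ffunE ?permK ?permKV //.
transitivity (\sum_(s : 'S_n) \sum_f
   (\prod_a Y (F f s a) a) * \det (rowsub (F f s) X)).
  rewrite -(card_Sn n) -cardsT -[LHS]sumr_const.
  under eq_bigl do rewrite inE.
  apply: eq_bigr => s _; rewrite det_gram.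
  by rewrite (reindex (F^~ s)) //=; apply: onW_bij.
rewrite exchange_big /=; apply: eq_bigr => f _.
rewrite -[\det (rowsub f Y)]det_tr [\det (rowsub f Y)^T]/determinant mulr_suml.
apply: eq_bigr => s _.
have -> : rowsub (F f s) X = perm_mx s *m rowsub f X.
  by rewrite -row_permE; apply/matrixP => a b; rewrite !mxE ffunE.
rewrite det_mulmx det_perm mulrCA mulrA; congr (_ * _); congr (_ * _).
by apply: eq_bigr => a _; rewrite !mxE ffunE.
Qed.

(** The coordinate projection onto [Q]. It writes principal submatrices as matrix products, so that
    Sylvester's identity applies to them. *)
Definition sel_mx n (Q : {set 'I_n}) : 'M[K]_(#|Q|, n) :=
  \matrix_(i, j) (enum_val i == j)%:R.

Lemma mul_sel_mx n p (Q : {set 'I_n}) (A : 'M[K]_(n, p)) :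
  sel_mx Q *m A = \matrix_(i, j) A (enum_val i) j.
Proof.
apply/matrixP => i j; rewrite !mxE (bigD1 (enum_val i)) //= !mxE eqxx mul1r.
rewrite big1 ?addr0 // => k /negPf kP; rewrite !mxE eq_sym kP mul0r //.
Qed.

Lemma mul_tr_sel_mx n p (Q : {set 'I_n}) (A : 'M[K]_(p, n)) :
  A *m (sel_mx Q)^T = \matrix_(i, j) A i (enum_val j).
Proof.
by rewrite -[A]trmxK -trmx_mul mul_sel_mx; apply/matrixP => i j; rewrite !mxE.
Qed.

Lemma sel_mxTK n (Q : {set 'I_n}) : sel_mx Q *m (sel_mx Q)^T = 1%:M.
Proof.
apply/matrixP => i j; rewrite mul_tr_sel_mx !mxE.
by rewrite (inj_eq enum_val_inj).
Qed.

Lemma tr_mul_sel_mx n (Q : {set 'I_n}) :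
  (sel_mx Q)^T *m sel_mx Q = \matrix_(i, j) ((i == j) && (i \in Q))%:R.
Proof.
apply/matrixP => i j; rewrite !mxE.
have [iQ|iQ] := boolP (i \in Q); last first.
  rewrite big1 ?andbF // => k _; rewrite !mxE.
  have -> : enum_val k == i = false.
    by apply: contraNF iQ => /eqP <-; apply: enum_valP.
  by rewrite mul0r.
rewrite (bigD1 (enum_rank_in iQ i)) //= !mxE enum_rankK_in // eqxx mul1r andbT.
rewrite big1 ?addr0 // => k kP; rewrite !mxE; have [ki|_] := eqVneq; last by rewrite mul0r.
by move: kP; rewrite -[X in _ != enum_rank_in _ X]ki enum_valK_in eqxx.
Qed.

(** The mixed matrix differs from the identity only in the rows of [Q], so the difference factors
    through [sel_mx Q], and Sylvester's identity moves the determinant to size [#|Q|]. *)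
Lemma det_mix_rows1 n (Q : {set 'I_n}) (A : 'M[K]_n) :
  \det (mix_rows Q A 1%:M) = \det (\matrix_(i < #|Q|, j < #|Q|) A (enum_val i) (enum_val j)).
Proof.
have -> : mix_rows Q A 1%:M = 1%:M + (sel_mx Q)^T *m (sel_mx Q *m A - sel_mx Q).
  rewrite mulmxBr mulmxA tr_mul_sel_mx; apply/matrixP => i j; rewrite !mxE.
  rewrite (bigD1 i) //= big1 ?addr0 => [|k /negPf ki]; last first.
    by rewrite mxE eq_sym ki mul0r.
  rewrite !mxE eqxx /=; case: (i \in Q); rewrite ?andbT ?andbF ?mul1r ?mul0r ?subr0 ?addr0 //.
  by rewrite addrCA subrr addr0.
rewrite det_1Dmul_comm mulmxBl sel_mxTK addrC subrK mul_sel_mx mul_tr_sel_mx.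
by congr (\det _); apply/matrixP => i j; rewrite !mxE.
Qed.

Lemma det_1DZ n (c : K) (A : 'M[K]_n) :
  \det (1%:M + c *: A) = \sum_(Q : {set 'I_n}) c ^+ #|Q| *
     \det (\matrix_(i < #|Q|, j < #|Q|) A (enum_val i) (enum_val j)).
Proof.
rewrite addrC det_mix_rowsD; apply: eq_bigr => Q _; rewrite det_mix_rows1.
rewrite -detZ; congr (\det _); by apply/matrixP => i j; rewrite !mxE.
Qed.

End DeterminantExpansions.

(** * Sums over injections *)

Section InjectionSums.
Variables (K : comNzRingType) (n m : nat).
Implicit Types (f : {ffun 'I_n -> 'I_m}) (U V : {set 'I_n}).

Definition upd f a x : {ffun 'I_n -> 'I_m} := [ffun b => if b == a then x else f b].

(** The map sending [(f, x)] to [(upd f a x, f a)] swaps the value at [a] with the spare value,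
    hence is an involution of the index set. *)
Lemma sum_upd (h : {ffun 'I_n -> 'I_m} -> K) a :
  \sum_f \sum_x h (upd f a x) = (\sum_f h f) *+ m.
Proof.
rewrite pair_big /= (reindex (fun p : _ * _ => (upd p.1 a p.2, p.1 a))) /=; last first.
  apply: onW_bij; apply: inv_bij => [[f x]] /=; rewrite /upd ffunE eqxx.
  by congr pair; apply/ffunP=> b; rewrite !ffunE; case: eqP => // ->.
transitivity (\sum_(p : {ffun 'I_n -> 'I_m} * 'I_m) h p.1).
  apply: eq_bigr => [[f x]] _ /=; congr h; apply/ffunP => b; rewrite !ffunE.
  by case: eqP => // ->.
rewrite -(pair_bigA _ (fun f (x : 'I_m) => h f)) /= -sumrMnl.
by apply: eq_bigr => f _; rewrite sumr_const card_ord.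
Qed.

(** Injectivity on [V], stated by cardinality so that adding a point to [V] becomes a comparison of
    numbers. *)
Definition inj_on V f := #|f @: V| == #|V|.

Lemma inj_on_upd V f a x : a \notin V ->
  inj_on (a |: V) (upd f a x) = (x \notin f @: V) && inj_on V f.
Proof.
move=> aV; have updE : upd f a x a = x by rewrite ffunE eqxx.
rewrite /inj_on imsetU1 updE.
have -> : upd f a x @: V = f @: V.
  apply: eq_in_imset => b bV; rewrite ffunE; case: eqP => // ba.
  by rewrite -ba bV in aV.
rewrite !cardsU1 aV; case: (x \in f @: V) => //=.
by rewrite add0n add1n; apply: ltn_eqF; rewrite ltnS leq_imset_card.
Qed.

(* Adding to the injectivity constraint a coordinate that [D] ignores
   multiplies the sum by the proportion of values left available. *)
Lemma sum_inj_on_step (D : {ffun 'I_n -> 'I_m} -> K) V a : a \notin V ->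
  (forall f x, D (upd f a x) = D f) ->
  (\sum_(f | inj_on (a |: V) f) D f) *+ m = (\sum_(f | inj_on V f) D f) *+ (m - #|V|).
Proof.
move=> aV DE; rewrite big_mkcond /= -(sum_upd _ a) -sumrMnl [RHS]big_mkcond /=.
apply: eq_bigr => f _.
under eq_bigr do rewrite inj_on_upd // DE.
case: (boolP (inj_on V f)) => [fV|_]; last by rewrite big1 // => x _; rewrite andbF.
rewrite -big_mkcond /= sumr_const; congr (_ *+ _).
transitivity #|~: (f @: V)|.
  by apply: eq_card => x; rewrite !inE unfold_in andbT.
by rewrite cardsCs finset.setCK card_ord (eqP fV).
Qed.

End InjectionSums.

Section InjectiveRowSelections.
Variables (K : numFieldType) (n m : nat).
Implicit Types (f : {ffun 'I_n -> 'I_m}) (U V : {set 'I_n}).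

Lemma prod_if_in (L : comNzRingType) (x y : L) U :
  \prod_a (if a \in U then x else y) = x ^+ #|U| * y ^+ (n - #|U|).
Proof.
rewrite (bigID (mem U)) /=; congr (_ * _).
  by rewrite (eq_bigr (fun=> x)) ?prodr_const // => a ->.
rewrite (eq_bigr (fun=> y)) => [|a /negPf ->//]; rewrite prodr_const; congr (_ ^+ _).
by rewrite -[n in (n - _)%N]card_ord -(cardC (mem U)) addKn.
Qed.

(** Points of [V] outside [U] are removed one at a time with [sum_inj_on_step]; the numbers of free
    values multiply to a falling factorial. Powers of [m] stay on the left, which avoids dividing by
    them. *)
Lemma sum_inj_on (D : {ffun 'I_n -> 'I_m} -> K) U V : U \subset V ->
  (forall f a x, a \notin U -> D (upd f a x) = D f) ->
  (\sum_(f | inj_on V f) D f) *+ m ^ (#|V| - #|U|)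
  = (\sum_(f | inj_on U f) D f) *+ (m - #|U|) ^_ (#|V| - #|U|).
Proof.
move=> UV DE; have [k] := ubnP #|V :\: U|; elim: k V UV => // k IH V UV Vk.
have [VU0|[a]] := finset.set_0Vmem (V :\: U).
  have -> : V = U by apply/eqP; rewrite finset.eqEsubset UV -finset.setD_eq0 VU0 eqxx.
  by rewrite subnn expn0 ffactn0.
rewrite inE => /andP [aU aV]; pose W := V :\ a.
have UW : U \subset W by rewrite subsetD1 UV.
have cV : #|V| = #|W|.+1 by rewrite (cardsD1 a V) aV.
have cW := subset_leq_card UW.
rewrite -(finset.setD1K aV) -/W cardsU1 !inE eqxx add1n subSn // expnS ffactnSr.
rewrite mulrnA sum_inj_on_step ?inE ?eqxx //; last by move=> f x; apply: DE.
rewrite -mulrnA mulnC mulrnA IH //; last first.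
  rewrite -ltnS; apply: leq_trans Vk; rewrite ltnS; apply: proper_card; apply/properP; split.
    by apply: finset.setSD; apply: finset.subsetDl.
  by exists a; rewrite !inE ?aU ?aV ?eqxx ?andbF.
by rewrite -mulrnA -subnDA subnKC.
Qed.

Lemma inj_onT f : inj_on finset.setT f = injectiveb f.
Proof.
apply/imset_injP/injectiveP => [fi a b|fi a b _ _]; last exact: fi.
by apply: fi; rewrite inE.
Qed.

(* Expanding each determinant over the set [U] of rows taken from the rank-one
   terms, the choices [f] that repeat a value on [U] contribute nothing and may
   be added to the sum for free. *)
Lemma sum_inj_det_rank1 (Psi : 'M[K]_n) (Y X : 'M[K]_(m, n)) : (n <= m)%N ->
  \sum_(f : {ffun 'I_n -> 'I_m} | injectiveb f)
    \det (\matrix_(a, b) (Psi a b + Y (f a) a * X (f a) b))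
  = \sum_(U : {set 'I_n}) ((m - #|U|)`!%:R / (m - n)`!%:R) *
      \det (mix_rows U (Y^T *m X) Psi).
Proof.
move=> nm; pose B f : 'M[K]_n := \matrix_(a, b) (Y (f a) a * X (f a) b).
transitivity (\sum_(f : {ffun 'I_n -> 'I_m} | injectiveb f)
               \sum_(U : {set 'I_n}) \det (mix_rows U (B f) Psi)).
  apply: eq_bigr => f _; rewrite -det_mix_rowsD; congr (\det _).
  by apply/matrixP => a b; rewrite !mxE addrC.
rewrite exchange_big /=; apply: eq_bigr => U _.
pose D f := \det (mix_rows U (B f) Psi).
have DE f a x : a \notin U -> D (upd f a x) = D f.
  move=> aU; congr (\det _); apply/matrixP => b c; rewrite !mxE ffunE.
  by case: eqP => // ->; rewrite (negPf aU).
have := @sum_inj_on D U finset.setT (finset.subsetT U) DE.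
have -> : \sum_(f | inj_on U f) D f = \sum_f D f.
  rewrite [RHS](bigID (inj_on U)) /= [X in _ + X]big1 ?addr0 // => f Nf.
  have [a [b [aU bU ab fab]]] : exists a b, [/\ a \in U, b \in U, a != b & f a = f b].
    have : ~~ dinjectiveb f U.
      by apply: contra Nf => /dinjectiveP ?; apply/imset_injP.
    case/dinjectivePn => a aU [b]; rewrite !inE => /andP [ba bU] fab.
    by exists a, b; split=> //; rewrite eq_sym.
  have [Ya|Ya] := eqVneq (Y (f a) a) 0.
    rewrite /D (expand_det_row _ a) big1 // => c _.
    by rewrite !mxE aU Ya !mul0r.
  (* Rows [a] and [b] are multiples of the same row of [X]. Pulling the two scalars out leaves a
     matrix with two equal rows. *)
  pose c i := if i == a then Y (f a) a else if i == b then Y (f b) b else 1.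
  pose A' : 'M[K]_n := \matrix_(i, j)
    if i == a then X (f a) j else if i == b then X (f b) j
    else mix_rows U (B f) Psi i j.
  rewrite /D; have -> : mix_rows U (B f) Psi = \matrix_(i, j) (c i * A' i j).
    apply/matrixP => i j; rewrite !mxE /c.
    by case: (eqVneq i a) => [->|_]; last case: (eqVneq i b) => [->|_];
      rewrite ?aU ?bU ?mul1r.
  rewrite det_scale_rows [X in _ * X](@determinant_alternate _ _ _ a b) ?mulr0 //.
  by move=> j; rewrite !mxE eqxx fab eq_sym (negPf ab) eqxx.
(* Over unrestricted [f] the sum factors row by row: a row in [U] adds up to a row of [Y^T *m X],
   and a row outside [U] is counted [m] times. *)
have -> : \sum_f D f = \det (mix_rows U (Y^T *m X) Psi) *+ m ^ (n - #|U|).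
  pose C i : 'M[K]_n := \matrix_(a, b) if a \in U then Y i a * X i b else Psi a b.
  transitivity (\det (\sum_i C i)).
    rewrite det_sum_rows; apply: eq_bigr => f _; congr (\det _).
    by apply/matrixP => a b; rewrite !mxE.
  pose c (a : 'I_n) : K := if a \in U then 1 else m%:R.
  have -> : \sum_i C i = \matrix_(a, b) (c a * mix_rows U (Y^T *m X) Psi a b).
    apply/matrixP => a b; rewrite summxE !mxE /c; case: ifP => aU.
      by rewrite mul1r; apply: eq_bigr => i _; rewrite !mxE aU.
    under eq_bigr do rewrite mxE aU.
    by rewrite sumr_const card_ord mulr_natl.
  rewrite det_scale_rows -[RHS]mulr_natl; congr (_ * _).
  by rewrite prod_if_in expr1n mul1r natrX.
rewrite cardsT card_ord => SE.
have Un : (#|U| <= n)%N by rewrite -[X in (_ <= X)%N]card_ord max_card.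
under eq_bigl do rewrite -inj_onT; rewrite -/D.
(* If [m = 0] then [n = 0] too, so the exponent vanishes and the power is 1. *)
have mX0 : (m ^ (n - #|U|))%:R != 0 :> K.
  have [m0|m0] := posnP m; last by rewrite pnatr_eq0 -lt0n expn_gt0 m0.
  have -> : (n - #|U| = 0)%N by lia.
  by rewrite expn0 oner_neq0.
apply: (mulIf mX0); rewrite !mulr_natr SE -mulrnA mulnC mulrnA; congr (_ *+ _).
rewrite -[LHS]mulr_natl; congr (_ * _).
apply: (canRL (mulfK _)); first by rewrite pnatr_eq0 -lt0n fact_gt0.
rewrite -natrM; congr (_%:R).
by rewrite -[RHS](@ffact_fact _ (n - #|U|)) ?leq_sub2r // -subnDA subnKC.
Qed.

(** Multiplying the characteristic polynomial by [det Psi] gives [det (X Psi - Sigma)]. Expanding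
    this by rows, the sets [U] of size [k] are those contributing to the coefficient of degree
    [n - k]. *)
Lemma char_poly_mix_rows (Psi Sigma : 'M[K]_n) k : Psi \in unitmx -> (k <= n)%N ->
  \sum_(U : {set 'I_n} | #|U| == k) \det (mix_rows U Sigma Psi)
  = \det Psi * ((-1) ^+ k * (char_poly (invmx Psi *m Sigma))`_(n - k)).
Proof.
move=> uPsi kn.
have E : (\det Psi)%:P * char_poly (invmx Psi *m Sigma)
       = \sum_(U : {set 'I_n}) ((-1) ^+ #|U| * \det (mix_rows U Sigma Psi)) *: 'X^(n - #|U|).
  rewrite /char_poly -det_map_mx -det_mulmx /char_poly_mx mulmxBr -map_mxM mulKVmx //.
  rewrite mul_mx_scalar addrC det_mix_rowsD; apply: eq_bigr => U _.
  pose c (a : 'I_n) : {poly K} := if a \in U then -1 else 'X.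
  have -> : mix_rows U (- map_mx polyC Sigma) ('X *: map_mx polyC Psi)
          = \matrix_(a, b) (c a * map_mx polyC (mix_rows U Sigma Psi) a b).
    by apply/matrixP => a b; rewrite !mxE /c; case: ifP; rewrite // mulN1r.
  rewrite det_scale_rows det_map_mx -mul_polyC polyCM.
  have -> : \prod_a c a = ((-1) ^+ #|U|)%:P * 'X^(n - #|U|).
    by rewrite prod_if_in rmorphXn /= polyCN.
  by rewrite mulrAC.
have := congr1 (fun p : {poly K} => p`_(n - k)) E; rewrite coefCM => E'.
rewrite mulrCA E' coef_sum mulr_sumr big_mkcond /=; apply: eq_bigr => U _.
rewrite coefZ coefXn.
have Un : (#|U| <= n)%N by rewrite -[X in (_ <= X)%N]card_ord max_card.
have -> : (n - k == n - #|U|)%N = (#|U| == k) by lia.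
case: eqP => [->|_]; last by rewrite !mulr0.
by rewrite mulr1 mulrA -exprD -signr_odd oddD addbb mul1r.
Qed.
End InjectiveRowSelections.

(** * Moments of the standard normal law *)

Section GaussianMoments.
Variable R : realType.
Let mu := @lebesgue_measure R.
Let N01 := @normal_prob R 0 1.

(** A nonnegative integral is a supremum over simple functions below the integrand, so monotonicity
    holds without measurability. This spares a measurability proof for the inner integrals of the
    logarithm. *)
Lemma ge0_le_integral_nomeas d (T : measurableType d) (nu : {measure set T -> \bar R})
  (f g : T -> \bar R) : (forall x, 0 <= f x)%E -> (forall x, f x <= g x)%E ->
  (\int[nu]_x f x <= \int[nu]_x g x)%E.
Proof.
move=> f0 fg; have g0 x : (0 <= g x)%E by apply: le_trans (fg x).
rewrite !ge0_integralTE //; apply: le_ereal_sup => _ [h /= hf <-].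
by exists h => //= x; apply: le_trans (fg x).
Qed.

(** The Radon-Nikodym derivative and [normal_pdf] have the same integral over every measurable set,
    so they agree almost everywhere. *)
Lemma ge0_integral_normal_prob (f : R -> \bar R) : (forall x, 0 <= f x)%E ->
  measurable_fun [set: R] f ->
  (\int[N01]_x f x = \int[mu]_x (f x * (normal_pdf 0 1 x)%:E))%E.
Proof.
move=> f0 mf.
have dom := @normal_prob_dominates R 0 1.
rewrite -(Radon_Nikodym_SigmaFinite.change_of_variables dom) //.
have mfRN : measurable_fun [set: R] (Radon_Nikodym_SigmaFinite.f (normal_prob 0 1) mu).
  exact: (measurable_int mu (Radon_Nikodym_SigmaFinite.f_integrable dom)).
apply: ae_eq_integral => //.
- exact: emeasurable_funM.
- apply: emeasurable_funM => //; apply/measurable_EFinP; exact: measurable_normal_pdf.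
- apply: ae_eqe_mul2l; apply: integral_ae_eq => //=.
  + exact: Radon_Nikodym_SigmaFinite.f_integrable.
  + apply/measurable_EFinP; exact: measurable_normal_pdf.
  + by move=> E _ mE; rewrite -Radon_Nikodym_SigmaFinite.f_integral.
Qed.


Let phi (x : R) := expR (- x ^+ 2 / 2).

Let dphi (x : R) : is_derive x 1 phi (- x * phi x).
Proof.
rewrite /phi; apply: is_derive_eq; rewrite /GRing.scale /=; by field.
Qed.

Let dxphi (x : R) : is_derive x 1 (fun x : R => x * phi x) ((1 - x ^+ 2) * phi x).
Proof.
have := dphi x => ?; apply: is_derive_eq; rewrite /GRing.scale /=; ring.
Qed.

Let cphi : continuous phi.
Proof.
move=> x; apply/differentiable_continuous/derivable1_diffP.
exact: (@ex_derive _ _ _ _ _ _ _ (dphi x)).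
Qed.

Let cxphi : continuous (fun x : R => x * phi x).
Proof.
move=> x; apply/differentiable_continuous/derivable1_diffP.
exact: (@ex_derive _ _ _ _ _ _ _ (dxphi x)).
Qed.

Let cvg_xphi : (fun x : R => x * phi x) @ +oo --> (0 : R).
Proof.
apply: (@squeeze_cvgr _ _ _ _ (cst 0) (fun x : R => 2 * x^-1)).
- near=> x; have x0 : 0 < x by near: x; exact: nbhs_pinfty_gt.
  rewrite mulr_ge0 ?expR_ge0 ?(ltW x0) //= /phi mulNr expRN.
  rewrite ler_pdivrMr ?expR_gt0 // mulrAC ler_pdivlMr // -expr2.
  have := expR_ge1Dx (x ^+ 2 / 2); lra.
- exact: cvg_cst.
- rewrite -(mulr0 2); apply: cvgM; first exact: cvg_cst.
  apply/gtr0_cvgV0; last exact: cvg_id.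
  by near=> x; near: x; exact: nbhs_pinfty_gt.
Unshelve. all: by end_near. Qed.


Let int_sq_phi :
  (\int[mu]_x (x ^+ 2 * phi x)%:E = \int[mu]_x (phi x)%:E)%E.
Proof.
have phi0 x : 0 <= phi x by exact: expR_ge0.
have csq : continuous (fun x : R => x ^+ 2 * phi x).
  by move=> x; apply: cvgM; [exact: sqr_continuous|exact: cphi].
have mphi : measurable_fun [set: R] phi by exact: continuous_measurable_fun.
have msq : measurable_fun [set: R] (fun x : R => x ^+ 2 * phi x).
  exact: continuous_measurable_fun.
have cf1 : continuous (fun x : R => (1 - x ^+ 2) * phi x).
  have -> : (fun x : R => (1 - x ^+ 2) * phi x) = (fun x => phi x - x ^+ 2 * phi x).
    by apply/funext => x; rewrite mulrBl mul1r.
  by move=> x; apply: cvgB; [exact: cphi|exact: csq].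
have cf2 : continuous (fun x : R => (x ^+ 2 - 1) * phi x).
  have -> : (fun x : R => (x ^+ 2 - 1) * phi x) = (fun x => x ^+ 2 * phi x - phi x).
    by apply/funext => x; rewrite mulrBl mul1r.
  by move=> x; apply: cvgB; [exact: csq|exact: cphi].
(* The derivative of [x * phi x] is [(1 - x ^+ 2) * phi x], and [x * phi x] vanishes at 0 and at
   infinity. The half-line is cut at 1, where this derivative changes sign, so that both pieces are
   integrals of nonnegative functions, each equal to [phi 1]. *)
have I1 : (\int[mu]_(x in `[0%R, 1%R]) ((1 - x ^+ 2) * phi x)%:E = (phi 1)%:E)%E.
  rewrite (@continuous_FTC2 _ _ (fun x => x * phi x)) ?ltr01 //.
  - by rewrite mul0r mul1r sube0.
  - exact: continuous_subspaceT.
  - split.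
    + by move=> x _; apply: (@ex_derive _ _ _ _ _ _ _ (dxphi x)).
    + exact/cvg_at_right_filter/cxphi.
    + exact/cvg_at_left_filter/cxphi.
  - by move=> x _; rewrite derive1E; apply: (@derive_val _ _ _ _ _ _ _ (dxphi x)).
have I2 : (\int[mu]_(x in `[1%R, +oo[) ((x ^+ 2 - 1) * phi x)%:E = (phi 1)%:E)%E.
  have dN (x : R) : is_derive x 1 (fun x : R => - (x * phi x)) ((x ^+ 2 - 1) * phi x).
    by have := dxphi x => ?; apply: is_derive_eq; ring.
  rewrite (@ge0_continuous_FTC2y _ _ (fun x => - (x * phi x)) _ 0) //.
  - by rewrite mul1r EFinN oppeK add0e.
  - move=> x x1; apply: mulr_ge0 => //; nra.
  - exact: continuous_subspaceT.
  - by rewrite -oppr0; apply: cvgN; exact: cvg_xphi.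
  - apply: cvg_at_right_filter; apply: cvgN; exact: cxphi.
  - by move=> x _; rewrite derive1E; apply: (@derive_val _ _ _ _ _ _ _ (dN x)).
have mE (D : set R) (f : R -> R) : measurable_fun [set: R] f -> measurable_fun D (EFin \o f).
  by move=> mf; apply/measurable_funTS/measurable_EFinP.
have J1 : (\int[mu]_(x in `[0%R, 1%R]) (phi x)%:E
           = (phi 1)%:E + \int[mu]_(x in `[0%R, 1%R]) (x ^+ 2 * phi x)%:E)%E.
  rewrite -I1 -ge0_integralD //=.
  - by apply: eq_integral => x _; rewrite -EFinD -mulrDl subrK mul1r.
  - move=> x; rewrite /= in_itv /= => /andP [x0 x1]; rewrite lee_fin mulr_ge0 //; nra.
  - by apply: mE; exact: continuous_measurable_fun.
  - by move=> x _; rewrite lee_fin mulr_ge0 ?sqr_ge0.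
  - exact: mE.
have J2 : (\int[mu]_(x in `[1%R, +oo[) (x ^+ 2 * phi x)%:E
           = (phi 1)%:E + \int[mu]_(x in `[1%R, +oo[) (phi x)%:E)%E.
  rewrite -I2 -ge0_integralD //=.
  - by apply: eq_integral => x _; rewrite -EFinD -{3}[phi x]mul1r -mulrDl subrK.
  - move=> x; rewrite /= in_itv /= => /andP [x0 x1]; rewrite lee_fin mulr_ge0 //; nra.
  - by apply: mE; exact: continuous_measurable_fun.
  - by move=> x _; rewrite lee_fin.
  - exact: mE.
have split (f : R -> R) : measurable_fun [set: R] f -> (forall x, 0 <= f x) ->
   (\int[mu]_(x in [set x | (0 <= x)%R]) (f x)%:E =
    \int[mu]_(x in `[0%R, 1%R]) (f x)%:E + \int[mu]_(x in `[1%R, +oo[) (f x)%:E)%E.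
  move=> mf f0.
  have -> : (\int[mu]_(x in `[1%R, +oo[) (f x)%:E = \int[mu]_(x in `]1%R, +oo[) (f x)%:E)%E.
    by rewrite integral_itv_obnd_cbnd //; exact: mE.
  have -> : [set x : R | 0 <= x] = `[0, 1] `|` `]1, +oo[.
    apply/seteqP; split=> x /=; rewrite !in_itv /=.
      by move=> x0; rewrite x0 andbT /=; case: (leP x 1) => _; [left|right].
    by rewrite andbT; case=> [/andP []//|x1]; exact: le_trans ler01 (ltW x1).
  rewrite ge0_integral_setU //.
  - exact: mE.
  - by move=> x _; rewrite lee_fin.
  - apply/disj_setPS => x [] /=; rewrite !in_itv /= andbT => /andP [_ x1].
    by rewrite ltNge x1.
rewrite ge0_symfun_integralT ?[RHS]ge0_symfun_integralT //; first last.
- by move=> x /=; rewrite sqrrN /phi sqrrN.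
- by move=> x; rewrite mulr_ge0 ?sqr_ge0.
- by move=> x /=; rewrite /phi sqrrN.
congr (_ * _)%E; rewrite !split //; last by move=> x; rewrite mulr_ge0 ?sqr_ge0.
by rewrite J1 J2 addeA [(_ + (phi 1)%:E)%E]addeC.
Qed.


Let normal_pdf01 x : normal_pdf (0 : R) 1 x = normal_peak 1 * phi x.
Proof.
rewrite normal_pdfE ?oner_eq0 // /normal_fun subr0 /phi.
by rewrite expr1n.
Qed.

Lemma normal_second_moment : (\int[normal_prob (0 : R) 1]_x (x ^+ 2)%:E = 1)%E.
Proof.
rewrite ge0_integral_normal_prob; last 2 first.
- by move=> x; rewrite lee_fin sqr_ge0.
- exact/measurable_EFinP.
have phi0 x : 0 <= phi x by exact: expR_ge0.
have mphi : measurable_fun [set: R] phi by exact: continuous_measurable_fun.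
have msq : measurable_fun [set: R] (fun x : R => x ^+ 2 * phi x).
  exact: measurable_funM.
rewrite -(@integral_normal_pdf R 0 1).
under eq_integral do rewrite normal_pdf01 -EFinM mulrCA EFinM.
under [RHS]eq_integral do rewrite normal_pdf01 EFinM.
have pk : (0 <= (normal_peak (1 : R))%:E)%E by rewrite lee_fin normal_peak_ge0.
rewrite !ge0_integralZl //; first by congr (_ * _)%E; exact: int_sq_phi.
- exact/measurable_EFinP.
- by move=> x _; rewrite lee_fin.
- exact/measurable_EFinP.
- by move=> x _; rewrite lee_fin mulr_ge0 ?sqr_ge0.
Qed.

Lemma integrable_normal_sq : (normal_prob (0 : R) 1).-integrable setT (fun x => (x ^+ 2)%:E).
Proof.
apply/integrableP; split; first exact/measurable_EFinP.
under eq_integral do rewrite /= ger0_norm ?sqr_ge0 //.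
by rewrite normal_second_moment ltry.
Qed.

Lemma integrable_normal_id : (normal_prob (0 : R) 1).-integrable setT (fun x => x%:E).
Proof.
have H : (normal_prob (0 : R) 1).-integrable setT (fun x => (1 + x ^+ 2)%:E).
  under eq_fun do rewrite EFinD.
  apply: integrableD => //; last exact: integrable_normal_sq.
  exact: finite_measure_integrable_cst.
apply: le_integrable H => //.
- exact/measurable_EFinP.
- move=> x _ /=; rewrite lee_fin [leRHS]ger0_norm ?addr_ge0 ?sqr_ge0 //.
  rewrite ler_norml; apply/andP; split; nra.
Qed.

Lemma ge0_integral_opp (f : R -> R) : continuous f -> (forall x, 0 <= f x) ->
  (\int[mu]_x (f x)%:E = \int[mu]_x (f (- x))%:E)%E.
Proof.
suff H (g : R -> R) : continuous g -> (forall x, 0 <= g x) ->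
    (\int[mu]_x (g x)%:E = \int[mu]_(x in `[0%R, +oo[) (g x)%:E
       + \int[mu]_(x in `[0%R, +oo[) (g (- x))%:E)%E.
  move=> cf f0; rewrite !H //.
    by rewrite addeC; congr (_ + _)%E; apply: eq_integral => x _; rewrite opprK.
  by move=> x; apply: continuous_comp; [exact: opp_continuous|exact: cf].
move=> cg g0.
have mg : measurable_fun [set: R] g by exact: continuous_measurable_fun.
have -> : [set: R] = `[0, +oo[ `|` `]-oo, 0[.
  apply/seteqP; split=> x //= _; rewrite !in_itv /= andbT.
  by case: (leP 0 x) => _; [left|right].
rewrite ge0_integral_setU //=.
- congr (_ + _)%E; rewrite integral_itv_bndo_bndc; last first.
    exact/measurable_EFinP/measurable_funTS.
  rewrite -{1}oppr0 ge0_integration_by_substitutionNy //.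
  exact: continuous_subspaceT.
- exact/measurable_EFinP/measurable_funTS.
- by move=> x _; rewrite lee_fin.
- apply/disj_setPS => x [] /=; rewrite !in_itv /= andbT => x1.
  by rewrite ltNge x1.
Qed.

Lemma normal_first_moment : (\int[normal_prob (0 : R) 1]_x x%:E = 0)%E.
Proof.
have phi0 x : 0 <= phi x by exact: expR_ge0.
rewrite integralE.
suff -> : (\int[normal_prob (0 : R) 1]_x (fun x => x%:E)^\+ x =
           \int[normal_prob (0 : R) 1]_x (fun x => x%:E)^\- x)%E.
  rewrite subee //.
  apply: integrable_fin_num => //; apply: integrable_funeneg => //.
  exact: integrable_normal_id.
(* The positive and negative parts of the identity are [p x] and [p (- x)]; since the density is
   even, they have equal integrals. *)
pose p (x : R) := (`|x| + x) / 2.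
have pE x : ((fun x : R => x%:E)^\+ x = (p x)%:E)%E.
  rewrite funeposE -EFin_max /p; congr EFin.
  by case: (leP x 0) => x0; [rewrite ler0_norm //|rewrite gtr0_norm //]; field.
have nE x : ((fun x : R => x%:E)^\- x = (p (- x))%:E)%E.
  rewrite funenegE -EFinN -EFin_max /p normrN; congr EFin.
  by case: (leP (- x) 0) => x0; [rewrite ger0_norm|rewrite ltr0_norm];
    rewrite -?oppr_le0 -?oppr_gt0 //; field.
have p0 x : 0 <= p x by rewrite -lee_fin -pE funepos_ge0.
have cp : continuous p.
  move=> x; apply: cvgM; last exact: cvg_cst.
  by apply: cvgD; [exact: norm_continuous|exact: cvg_id].
have cpN : continuous (fun x => p (- x)).
  by move=> x; apply: continuous_comp; [exact: opp_continuous|exact: cp].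
under eq_integral do rewrite pE.
under [RHS]eq_integral do rewrite nE.
rewrite !ge0_integral_normal_prob; last 4 first.
- by move=> x; rewrite lee_fin.
- by apply/measurable_EFinP; exact: continuous_measurable_fun.
- by move=> x; rewrite lee_fin.
- by apply/measurable_EFinP; exact: continuous_measurable_fun.
transitivity (\int[mu]_x (p x * normal_pdf 0 1 x)%:E)%E; first exact: eq_integral.
rewrite ge0_integral_opp.
- by apply: eq_integral => x _; rewrite !normal_pdf01 /phi sqrrN.
- move=> x; apply: cvgM; first exact: cp.
  by apply: continuous_normal_pdf; rewrite oner_eq0.
- by move=> x; rewrite mulr_ge0 // normal_pdf_ge0.
Qed.

Lemma normal_quadratic (a b c : R) :
  (\int[normal_prob (0 : R) 1]_x (a + b * x + c * x ^+ 2)%:E = (a + c)%:E)%E.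
Proof.
under eq_integral do rewrite !EFinD !EFinM.
have ib : (normal_prob (0 : R) 1).-integrable setT (fun x => b%:E * x%:E)%E.
  by apply: integrableZl => //; exact: integrable_normal_id.
have ic : (normal_prob (0 : R) 1).-integrable setT (fun x => c%:E * (x ^+ 2)%:E)%E.
  by apply: integrableZl => //; exact: integrable_normal_sq.
have ia : (normal_prob (0 : R) 1).-integrable setT (fun=> a%:E).
  exact: finite_measure_integrable_cst.
rewrite integralD //; last exact: integrableD.
have Ia : (\int[normal_prob (0 : R) 1]_x a%:E = a%:E)%E.
  rewrite integral_cst // -[RHS]mule1; congr (_ * _)%E.
  exact: (@probability_setT _ _ _ (normal_prob 0 1)).
rewrite integralD // Ia.
rewrite !integralZl ?integrable_normal_id ?integrable_normal_sq //.
by rewrite normal_first_moment normal_second_moment mule0 mule1 adde0.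
Qed.

End GaussianMoments.

(** * The function J *)

Section ShiftedCompanion.
Variable F : fieldType.
Implicit Types c u : nat -> F.

(** The companion matrix of [X^(l+1) - sum_k u_k X^k], last column [u], with [c] added along the
    diagonal. *)
Definition shifted_companion (l : nat) c u : 'M[F]_l.+1 :=
  \matrix_(k, j) ((k == j)%:R * c j + (k == j.+1 :> nat)%:R + (j == l :> nat)%:R * u k).

(** Row 0 has only [c 0] in the first column and [u 0] in the last. The first cofactor is the same
    determinant for shifted sequences, and the second comes from a triangular matrix with unit
    diagonal. *)
Lemma det_shifted_companion l c u : \det (shifted_companion l c u) =
  \prod_(j < l.+1) c j + \sum_(k < l.+1) (-1) ^+ (l - k) * u k * \prod_(j < k) c j.
Proof.
elim: l c u => [|l IH] c u.
  by rewrite det_mx11 !mxE !big_ord1 big_ord0 /= subnn; ring.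
rewrite (expand_det_row _ ord0) [LHS]big_ord_recl [X in _ + X = _]big_ord_recr /=.
rewrite [X in _ + (X + _) = _]big1 ?add0r; last first.
  move=> i _; rewrite !mxE /= /bump /= add1n eqSS ltn_eqF //.
  by rewrite !mul0r !addr0 mul0r.
have -> : cofactor (shifted_companion l.+1 c u) ord0 ord0 =
          \det (shifted_companion l (c \o S) (u \o S)).
  rewrite /cofactor expr0 mul1r; congr (\det _); apply/matrixP => k j; rewrite !mxE.
  by rewrite (inj_eq lift_inj).
have -> : cofactor (shifted_companion l.+1 c u) ord0 (lift ord0 ord_max) = (-1) ^+ l.+1.
  rewrite /cofactor /= -det_tr det_trig; last first.
    apply/is_trig_mxP => i j ij; rewrite !mxE /= /bump /=.
    rewrite -val_eqE /= /bump /=.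
    have := ltn_ord j; have := ltn_ord i.
    set ii := nat_of_ord i in ij *; set jj := nat_of_ord j in ij *.
    case: (leqP l.+1 ii) => ? ?; first lia. move=> ?.
    rewrite add1n /= add0n.
    have -> : (jj.+1 == ii) = false by lia.
    have -> : (jj.+1 == ii.+1) = false by lia.
    have -> : (ii == l.+1) = false by lia.
    by rewrite !mul0r !addr0.
  rewrite big1 ?mulr1 // => i _; rewrite !mxE /= -val_eqE /= /bump /=.
  have := ltn_ord i; rewrite ltnS leqNgt => /negPf ->; rewrite add0n add1n eqxx.
  have -> : ((i.+1 == i) = false)%N by lia.
  have := ltn_ord i => il; have -> : ((i == l.+1 :> nat) = false)%N by lia.
  by rewrite !mul0r add0r addr0.
have -> : shifted_companion l.+1 c u ord0 ord0 = c 0%N by rewrite mxE /=; ring.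
have -> : shifted_companion l.+1 c u ord0 (lift ord0 ord_max) = u 0%N.
  by rewrite mxE /= /bump /= add1n eqxx mul1r mul0r !add0r.
rewrite IH /= [in RHS]big_ord_recl [X in _ = _ + X]big_ord_recl big_ord0 mulr1 subn0 mulrDr.
rewrite -addrA [X in _ = _ + X]addrC; congr (_ + (_ + _)); last by rewrite mulrC.
rewrite mulr_sumr; apply: eq_bigr => k _.
by rewrite [in RHS]big_ord_recl /= -[bump 0 k]/(k.+1) subSS; ring.
Qed.

(* In the basis 1, x, ..., x^(L-1) of F[x] modulo p = prod (x - th_i), the
   columns (c_j + x) x^j form a companion matrix with the c_j added to its
   diagonal. *)
Lemma det_shifted_Vandermonde L c (th : 'rV[F]_L) :
  let p := \prod_(i < L) ('X - (th 0 i)%:P) in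
  \det (\matrix_(i < L, j < L) ((c j + th 0 i) * th 0 i ^+ j)) =
  (\prod_(i < L) \prod_(j < L | (i < j)%N) (th 0 j - th 0 i)) *
  \sum_(k < L.+1) (-1) ^+ (L - k) * p`_k * \prod_(j < k) c j.
Proof.
move=> p; case: L th @p => [|l] th p.
  by rewrite det_mx00 !big_ord0 mul1r big_ord1 /p !big_ord0 coef1 expr0 !mulr1.
have sp : size p = l.+2 by rewrite size_prod_XsubC /index_enum -enumT size_enum_ord.
have mp : p \is monic by apply: monic_prod_XsubC.
have pl : p`_l.+1 = 1 by move/monicP: mp; rewrite /lead_coef sp.
rewrite -det_Vandermonde -[LHS]det_tr.
have -> : (\matrix_(i < l.+1, j < l.+1) ((c j + th 0 i) * th 0 i ^+ j))^T =
   (shifted_companion l c (fun k => - p`_k))^T *m Vandermonde l.+1 th.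
  apply/matrixP => j i; rewrite !mxE.
  have pi0 : p.[th 0 i] = 0.
    by rewrite /p horner_prod (bigD1 i) //= hornerXsubC subrr mul0r.
  (* At a root of the monic [p], the power [l + 1] reduces to lower powers; this produces the last
     column, with [u_k = - p_k]. *)
  have pE : th 0 i ^+ l.+1 = - \sum_(k < l.+1) p`_k * th 0 i ^+ k.
    have := pi0; rewrite horner_coef sp big_ord_recr /= pl mul1r => /eqP.
    by rewrite addrC addr_eq0 => /eqP.
  under eq_bigr do rewrite !mxE !mulrDl.
  rewrite !big_split /= mulrDl -exprS -addrA; congr (_ + _).
    rewrite (bigD1 j) //= eqxx mul1r big1 ?addr0 // => k /negPf ->.
    by rewrite !mul0r.
  have := ltn_ord j; rewrite ltnS leq_eqVlt => /orP [/eqP jl|jl].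
    rewrite [X in X + _]big1 ?add0r => [|k _]; last first.
      by rewrite jl ltn_eqF ?mul0r.
    rewrite jl pE -sumrN; apply: eq_bigr => k _.
    by rewrite eqxx mul1r mulNr.
  rewrite [X in _ + X]big1 ?addr0 => [|k _]; last by rewrite ltn_eqF // !mul0r.
  have jl' : (j.+1 < l.+1)%N by [].
  rewrite (bigD1 (Ordinal jl')) //= eqxx mul1r big1 ?addr0 // => k.
  by rewrite -val_eqE /= => /negPf ->; rewrite mul0r.
rewrite det_mulmx det_tr det_shifted_companion mulrC; congr (_ * _).
(* The full product of the [c j] is the term [k = l + 1], whose coefficient is 1 because [p] is
   monic. *)
rewrite [RHS]big_ord_recr /= subnn pl !mul1r addrC; congr (_ + _).
apply: eq_bigr => k _; rewrite subSn; last by rewrite -ltnS.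
by rewrite exprS; ring.
Qed.
End ShiftedCompanion.

Section JLimit.
Variable R : realType.

(** The value of [J] written through the coefficients of the polynomial with the given roots. It
    involves no division, hence is continuous also where roots coincide. *)
Definition Jpoly (q : int) L (p : {poly R}) : R :=
  \sum_(k < L.+1) (-1) ^+ (L - k) * p`_k * \prod_(j < k) (q - L%:Z + (j.+1)%:Z)%:~R.

Definition row_poly L (th : 'rV[R]_L) : {poly R} := \prod_(i < L) ('X - (th 0 i)%:P).

Lemma Jraw_distinct q L (th : 'rV[R]_L) : distinct_pts th ->
  Jraw q th = Jpoly q L (row_poly th).
Proof.
move=> dth; rewrite /Jraw (det_shifted_Vandermonde (fun j => (q - L%:Z + j.+1%:Z)%:~R)).
rewrite mulrAC divff ?mul1r //.
apply/prodf_neq0 => i _; apply/prodf_neq0 => j ij.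
by rewrite subr_eq0; apply: dth; rewrite -val_eqE /= gtn_eqF.
Qed.

Lemma continuous_coef_prod L (I : Type) (r : seq I) (f : I -> 'rV[R]_L -> {poly R}) :
  (forall i k, continuous (fun th => (f i th)`_k)) ->
  forall k, continuous (fun th => (\prod_(i <- r) f i th)`_k).
Proof.
move=> cf; elim: r => [|i r IH] k.
  by under eq_fun do rewrite big_nil; exact: cst_continuous.
under eq_fun do rewrite big_cons coefM.
move=> th; apply: (@cvg_big _ _ _ _ _ add_continuous _ (nbhs th)) => j _.
by apply: cvgM; [exact: cf|exact: IH].
Qed.

Lemma continuous_Jpoly q L : continuous (fun th : 'rV[R]_L => Jpoly q L (row_poly th)).
Proof.
move=> th; apply: (@cvg_big _ _ _ _ _ add_continuous _ (nbhs th)) => k _.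
apply: cvgM; last exact: cvg_cst; apply: cvgM; first exact: cvg_cst.
apply: (@continuous_coef_prod L _ _ (fun i (th : 'rV[R]_L) => 'X - (th 0 i)%:P)) => i j.
under eq_fun do rewrite coefB coefC.
move=> x; apply: (@cvgB _ _ _ (nbhs x)); first exact: cvg_cst.
by case: (j == 0%N); [exact: coord_continuous|exact: cvg_cst].
Qed.

(** Along [th + e (0, 1, 2, ...)] with small nonzero [e], equal coordinates separate and different
    ones stay apart. This makes the filter in [Jlim] proper, so its limit is unique. *)
Lemma closure_distinct_pts L (th : 'rV[R]_L) : closure (@distinct_pts R L) th.
Proof.
move=> B [P Pth PB].
have cline (a b : R) : (fun e : R => a + e * b) @ (0 : R)^' --> a.
  have -> : nbhs a = nbhs (a + 0 * b) by rewrite mul0r addr0.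
  apply: cvg_within_filter; apply: cvgD; first exact: cvg_cst.
  by apply: cvgM; [exact: cvg_id|exact: cvg_cst].
have nearP : \forall e \near (0 : R)^', forall i : 'I_L, P 0 i (th 0 i + e * i%:R).
  by apply: filter_forall => i; apply: cline; exact: Pth.
have nearD : \forall e \near (0 : R)^', forall p : 'I_L * 'I_L, p.1 != p.2 ->
    th 0 p.1 + e * p.1%:R != th 0 p.2 + e * p.2%:R.
  apply: filter_forall => -[i j] /=.
  have [tE|tE] := eqVneq (th 0 i) (th 0 j).
    near=> e => ij; rewrite tE (inj_eq (addrI _)) (inj_eq (mulfI _)) ?eqr_nat //.
    by near: e; exact: nbhs_dnbhs_neq.
  have := cline (th 0 i - th 0 j) (i%:R - j%:R).
  move=> /cvgr_neq0; rewrite subr_eq0 => /(_ tE); apply: filterS => e + _.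
  by apply: contra_neq => E; have := E; lra.
have [e [eP eD]] := filter_ex (filterI nearP nearD).
exists (\row_i (th 0 i + e * i%:R)); split.
  by move=> i j ij; rewrite !mxE; exact: (eD (i, j)).
by apply: PB => i j; rewrite mxE !ord1; exact: eP.
Unshelve. all: by end_near. Qed.

Lemma JlimE q L (th : 'rV[R]_L) : Jlim q th = Jpoly q L (row_poly th).
Proof.
have PF := @within_nbhs_proper 'rV[R]_L _ _ (@closure_distinct_pts L th).
rewrite /Jlim; apply: cvg_lim; first exact: Rhausdorff.
apply: (@cvg_trans _ ((fun x => Jpoly q L (row_poly x)) @
    within (@distinct_pts R L) (nbhs th))); last first.
  by apply: cvg_within_filter; exact: continuous_Jpoly.
apply: near_eq_cvg.
have : \forall x \near th, distinct_pts x -> Jpoly q L (row_poly x) = Jraw q x.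
  by apply: (@nearW _ (nbhs th)) => x dx; rewrite Jraw_distinct.
exact.
Qed.

End JLimit.

(** * Averages over signs and Gaussian expectations *)

Section SignAverages.
Variable R : realType.

Fixpoint sign_avg (K : numFieldType) (n : nat) (f : seq R -> K) : K :=
  match n with
  | 0 => f [::]
  | n'.+1 => 2^-1 * (sign_avg n' (fun s => f (1 :: s)) +
                     sign_avg n' (fun s => f (-1 :: s)))
  end.

Section Linearity.
Variable K : numFieldType.
Implicit Types f g : seq R -> K.

Lemma eq_sign_avg n f g : f =1 g -> sign_avg n f = sign_avg n g.
Proof. by move=> /funext ->. Qed.

Lemma sign_avgD n f g :
  sign_avg n (fun s => f s + g s) = sign_avg n f + sign_avg n g.
Proof.
by elim: n f g => [|n IH] f g //=; rewrite !IH -mulrDr; congr (_ * _); ring.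
Qed.

Lemma sign_avgZ n (c : K) f : sign_avg n (fun s => c * f s) = c * sign_avg n f.
Proof. by elim: n f => [|n IH] f //=; rewrite !IH -mulrDr mulrCA. Qed.

Lemma sign_avg_cst n (c : K) : sign_avg n (fun=> c) = c.
Proof. by elim: n => //= n ->; field. Qed.

Lemma sign_avg_sum n (I : Type) (r : seq I) (P : pred I) (F : I -> seq R -> K) :
  sign_avg n (fun s => \sum_(i <- r | P i) F i s)
  = \sum_(i <- r | P i) sign_avg n (F i).
Proof.
elim: r => [|i r IH].
  by rewrite big_nil -[RHS](sign_avg_cst n); apply: eq_sign_avg => s; rewrite big_nil.
rewrite big_cons -IH; case: ifP => Pi; last first.
  by apply: eq_sign_avg => s; rewrite big_cons Pi.
by rewrite -sign_avgD; apply: eq_sign_avg => s; rewrite big_cons Pi.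
Qed.

Lemma le_sign_avg n f g : (forall s, f s <= g s) -> sign_avg n f <= sign_avg n g.
Proof.
elim: n f g => [|n IH] f g fg //=.
by rewrite ler_pM2l ?invr_gt0 ?ltr0n //; apply: lerD; apply: IH.
Qed.

Definition depends_on (T : Type) (V : pred nat) (f : seq R -> T) :=
  forall s s', size s = size s' ->
    (forall k, V k -> nth 0 s k = nth 0 s' k) -> f s = f s'.

Lemma depends_on_cons T (V : pred nat) (f : seq R -> T) x :
  depends_on V f -> depends_on (V \o S) (fun s => f (x :: s)).
Proof. by move=> Vf s s' ss H; apply: Vf => [/=|[//|k] Vk /=]; rewrite ?ss //; apply: H. Qed.

Lemma depends_on_head T (V : pred nat) (f : seq R -> T) x y s :
  depends_on V f -> ~~ V 0%N -> f (x :: s) = f (y :: s).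
Proof. by move=> Vf V0; apply: Vf => // -[|k] Vk //; rewrite Vk in V0. Qed.

Lemma sub_depends_on T (V W : pred nat) (f : seq R -> T) :
  (forall k, V k -> W k) -> depends_on V f -> depends_on W f.
Proof. by move=> VW Vf s s' ss H; apply: Vf => // k Vk; apply: H; apply: VW. Qed.

(** Induction on the coordinates: the head sign is read by at most one of the two functions, so the
    other factor is the same for both signs and can be taken out. *)
Lemma sign_avg_indep n (V : pred nat) f g :
  depends_on V f -> depends_on (predC V) g ->
  sign_avg n (fun s => f s * g s) = sign_avg n f * sign_avg n g.
Proof.
elim: n V f g => [|n IH] V f g Vf Vg //=.
have IH' x y : sign_avg n (fun s => f (x :: s) * g (y :: s)) =
    sign_avg n (fun s => f (x :: s)) * sign_avg n (fun s => g (y :: s)).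
  exact: IH (depends_on_cons _ Vf) (depends_on_cons _ Vg).
rewrite !IH'; have [V0|V0] := boolP (V 0%N).
  have -> : (fun s => g (-1 :: s)) = (fun s => g (1 :: s)).
    by apply/funext => s; apply: (depends_on_head _ _ _ Vg); rewrite /= V0.
  by field.
have -> : (fun s => f (-1 :: s)) = (fun s => f (1 :: s)).
  by apply/funext => s; apply: (depends_on_head _ _ _ Vf).
by field.
Qed.

Lemma depends_on_prod (I : eqType) (r : seq I) (V : pred nat) (h : I -> seq R -> K) :
  (forall i, i \in r -> depends_on V (h i)) ->
  depends_on V (fun s => \prod_(i <- r) h i s).
Proof.
move=> H s s' ss E; apply: eq_big_seq => i ir; exact: H ir _ _ ss E.
Qed.

(** [lab] sorts the coordinates into blocks. Each factor reads one block, and different factors read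
    different blocks. *)
Lemma sign_avg_prod n (lab : nat -> nat) (I : eqType) (l : I -> nat) (r : seq I)
    (h : I -> seq R -> K) :
  uniq (map l r) -> (forall i, depends_on (fun k => lab k == l i) (h i)) ->
  sign_avg n (fun s => \prod_(i <- r) h i s) = \prod_(i <- r) sign_avg n (h i).
Proof.
move=> + H; elim: r => [_|i r IH /= /andP [ir ur]].
  by rewrite big_nil -[RHS](sign_avg_cst n); apply: eq_sign_avg => s; rewrite big_nil.
rewrite big_cons -IH // -(@sign_avg_indep _ (fun k => lab k == l i)) //.
  by apply: eq_sign_avg => s; rewrite big_cons.
apply: depends_on_prod => j jr; apply: sub_depends_on (H j) => k /= /eqP ->.
by apply: contra ir => /eqP <-; apply: map_f.
Qed.

End Linearity.

Section DegreeTwo.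
Variable K : comNzRingType.

(** The degree bound is per coordinate, not joint, which is what iterated integration requires. The
    map [e] embeds the real coordinate into the ring of values, so that complex functions are
    covered. *)
Definition quadratic_each (e : R -> K) n (f : seq R -> K) :=
  forall s1 s2, (size s1 + size s2).+1 = n ->
    exists a b c, forall x, f (s1 ++ x :: s2) = a + b * e x + c * e x ^+ 2.

Definition affine_each (e : R -> K) n (f : seq R -> K) :=
  forall s1 s2, (size s1 + size s2).+1 = n ->
    exists a b, forall x, f (s1 ++ x :: s2) = a + b * e x.

Variables (e : R -> K) (n : nat).
Local Notation quad := (quadratic_each e n).

Lemma quadratic_each_cst c : quad (fun=> c).
Proof. by move=> s1 s2 _; exists c, 0, 0 => x; rewrite !mul0r !addr0. Qed.

Lemma quadratic_eachD f g : quad f -> quad g -> quad (fun s => f s + g s).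
Proof.
move=> Hf Hg s1 s2 sn; have [a [b [c E]]] := Hf _ _ sn.
have [a' [b' [c' E']]] := Hg _ _ sn.
by exists (a + a'), (b + b'), (c + c') => x; rewrite E E'; ring.
Qed.

Lemma quadratic_eachZ c f : quad f -> quad (fun s => c * f s).
Proof.
move=> Hf s1 s2 sn; have [a [b [d E]]] := Hf _ _ sn.
by exists (c * a), (c * b), (c * d) => x; rewrite E; ring.
Qed.

Lemma quadratic_each_sum (I : Type) (r : seq I) (P : pred I) (F : I -> seq R -> K) :
  (forall i, P i -> quad (F i)) -> quad (fun s => \sum_(i <- r | P i) F i s).
Proof.
move=> HF; elim: r => [|i r IH].
  by under eq_fun do rewrite big_nil; exact: quadratic_each_cst.
have [Pi|/negPf Pi] := boolP (P i); under eq_fun do rewrite big_cons Pi; last by [].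
exact: quadratic_eachD (HF _ Pi) IH.
Qed.

Lemma affine_eachM f g : affine_each e n f -> affine_each e n g ->
  quad (fun s => f s * g s).
Proof.
move=> Hf Hg s1 s2 sn; have [a [b E]] := Hf _ _ sn; have [a' [b' E']] := Hg _ _ sn.
by exists (a * a'), (a * b' + b * a'), (b * b') => x; rewrite E E'; ring.
Qed.

Lemma affine_each_cst c : affine_each e n (fun=> c).
Proof. by move=> s1 s2 _; exists c, 0 => x; rewrite mul0r addr0. Qed.

Lemma affine_eachD f g : affine_each e n f -> affine_each e n g ->
  affine_each e n (fun s => f s + g s).
Proof.
move=> Hf Hg s1 s2 sn; have [a [b E]] := Hf _ _ sn; have [a' [b' E']] := Hg _ _ sn.
by exists (a + a'), (b + b') => x; rewrite E E'; ring.
Qed.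

Lemma affine_eachZ c f : affine_each e n f -> affine_each e n (fun s => c * f s).
Proof.
move=> Hf s1 s2 sn; have [a [b E]] := Hf _ _ sn.
by exists (c * a), (c * b) => x; rewrite E; ring.
Qed.

Lemma affine_each_sum (I : Type) (r : seq I) (F : I -> seq R -> K) :
  (forall i, affine_each e n (F i)) -> affine_each e n (fun s => \sum_(i <- r) F i s).
Proof.
move=> HF; elim: r => [|i r IH].
  by under eq_fun do rewrite big_nil; exact: affine_each_cst.
by under eq_fun do rewrite big_cons; exact: affine_eachD (HF i) IH.
Qed.

Lemma affine_each_nth k : affine_each e n (fun s => e (nth 0 s k)).
Proof.
move=> s1 s2 _; have [ks|ks|ks] := ltngtP k (size s1).
- by exists (e (nth 0 s1 k)), 0 => x; rewrite nth_cat ks mul0r addr0.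
- exists (e (nth 0 (0 :: s2) (k - size s1))), 0 => x.
  rewrite nth_cat ltnNge (ltnW ks) /= mul0r addr0.
  by case: (k - size s1)%N (subn_gt0 (size s1) k) => [|//]; rewrite ks.
- by exists 0, 1 => x; rewrite nth_cat ks ltnn subnn /= add0r mul1r.
Qed.

(** Degrees do not add up under the product: a given coordinate lies in one block, so at most one
    factor varies with it. *)
Lemma quadratic_each_prod (lab : nat -> nat) (I : eqType) (l : I -> nat) (r : seq I)
    (h : I -> seq R -> K) :
  uniq (map l r) -> (forall i, depends_on (fun k => lab k == l i) (h i)) ->
  (forall i, quad (h i)) -> quad (fun s => \prod_(i <- r) h i s).
Proof.
move=> ur H Q s1 s2 sn.
have const i x : lab (size s1) != l i -> h i (s1 ++ x :: s2) = h i (s1 ++ 0 :: s2).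
  move=> li; apply: H => [|k /eqP lk]; first by rewrite !size_cat.
  rewrite !nth_cat; case: ltnP => // ks.
  case E: (k - size s1)%N => //; move: li; rewrite -lk.
  have -> : k = size s1 by apply/eqP; rewrite eqn_leq ks andbT -subn_eq0 E.
  by rewrite eqxx.
elim: r ur => [_|i r IH /= /andP [ir ur]].
  by exists 1, 0, 0 => x; rewrite big_nil !mul0r !addr0.
have [li|li] := eqVneq (lab (size s1)) (l i); last first.
  have [a [b [c E]]] := IH ur; set d := h i (s1 ++ 0 :: s2).
  exists (d * a), (d * b), (d * c) => x; rewrite big_cons E const //; rewrite -/d; ring.
have [a [b [c E]]] := Q i _ _ sn; pose d := \prod_(j <- r) h j (s1 ++ 0 :: s2).
exists (d * a), (d * b), (d * c) => x; rewrite big_cons E.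
rewrite (eq_big_seq (fun j => h j (s1 ++ 0 :: s2))); first by rewrite -/d; ring.
move=> j jr; apply: const; rewrite li; apply: contra ir => /eqP ->; exact: map_f.
Qed.

End DegreeTwo.

Section GaussianExpectation.

(** Once the later coordinates are averaged, the result must still be quadratic in the first for its
    normal integral to be computed. *)
Lemma sign_avg_quadratic n (f : R -> seq R -> R) :
  (forall s, size s = n -> exists a b c, forall x, f x s = a + b * x + c * x ^+ 2) ->
  exists a b c, forall x, sign_avg n (f x) = a + b * x + c * x ^+ 2.
Proof.
elim: n f => [|n IH] f H /=; first exact: H.
have Hc y : exists a b c, forall x,
    sign_avg n (fun s => f x (y :: s)) = a + b * x + c * x ^+ 2.
  by apply: (IH (fun x s => f x (y :: s))) => s sn; apply: H; rewrite /= sn.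
have [a [b [c E]]] := Hc 1; have [a' [b' [c' E']]] := Hc (-1).
exists (2^-1 * (a + a')), (2^-1 * (b + b')), (2^-1 * (c + c')) => x.
by rewrite E E'; ring.
Qed.

(* A standard normal variable and a random sign have the same moments up to
   order two. *)
Lemma gauss_expect_sign_avg n (f : seq R -> R) : quadratic_each id n f ->
  gauss_expect n (fun s => (f s)%:E) = (sign_avg n f)%:E.
Proof.
elim: n f => [|n IH] f Q //=.
under eq_integral => x _.
  rewrite IH; last by move=> s1 s2 sn; apply: (Q (x :: s1)); rewrite /= addSn sn.
  over.
have [a [b [c E]]] := @sign_avg_quadratic n (fun x s => f (x :: s))
  (fun s sn => Q [::] s (congr1 S sn)).
under eq_integral do rewrite E.
by rewrite normal_quadratic !E; congr EFin; field.
Qed.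

Lemma gauss_expect_ge0 n (f : seq R -> \bar R) : (forall s, 0 <= f s)%E ->
  (0 <= gauss_expect n f)%E.
Proof. by elim: n f => [|n IH] f f0 //=; apply: integral_ge0 => x _; apply: IH. Qed.

Lemma le_gauss_expect n (f g : seq R -> \bar R) : (forall s, 0 <= f s)%E ->
  (forall s, f s <= g s)%E -> (gauss_expect n f <= gauss_expect n g)%E.
Proof.
elim: n f g => [|n IH] f g f0 fg //=.
apply: ge0_le_integral_nomeas => x; last exact: IH.
exact: gauss_expect_ge0.
Qed.

(* Jensen's inequality through the tangent line of [ln] at the mean. *)
Lemma gauss_expect_log2 n (F : seq R -> R) : quadratic_each id n F ->
  (forall s, 1 <= F s) ->
  (gauss_expect n (fun s => (log2 (F s))%:E) <= (log2 (sign_avg n F))%:E)%E.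
Proof.
move=> QF F1; set a := sign_avg n F.
have a0 : 0 < a.
  by apply: lt_le_trans ltr01 _; rewrite -(sign_avg_cst n 1); exact: le_sign_avg.
have l2 : 0 < ln 2 :> R by rewrite ln_gt0 // ltr1n.
(* [g] is the tangent line of [log2] at [a], evaluated at [F s]; its mean is exactly [log2 a]. *)
pose g s := (ln 2)^-1 * (ln a - 1) + ((ln 2)^-1 * a^-1) * F s.
have Qg : quadratic_each id n g.
  by apply: quadratic_eachD; [exact: quadratic_each_cst|exact: quadratic_eachZ].
have -> : (log2 a)%:E = gauss_expect n (fun s => (g s)%:E).
  rewrite gauss_expect_sign_avg // sign_avgD sign_avg_cst sign_avgZ -/a; congr EFin.
  by rewrite /log2; field; rewrite !gt_eqF.
apply: le_gauss_expect => s; rewrite lee_fin /log2.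
  by apply: divr_ge0; [exact: ln_ge0|exact: ltW].
have F0 : 0 < F s by exact: lt_le_trans ltr01 (F1 s).
have : ln (F s / a) <= F s / a - 1.
  have := @le_ln1Dx R (F s / a - 1); rewrite subrKC; apply.
  by have := divr_gt0 F0 a0; lra.
rewrite ln_div ?posrE // => H.
rewrite /g -mulrA -mulrDr [leLHS]mulrC ler_pM2l ?invr_gt0 //.
by rewrite [a^-1 * _]mulrC; lra.
Qed.

End GaussianExpectation.
End SignAverages.

(** * J at the nonzero eigenvalues, in terms of factorials *)

Section JseqFactorials.
Variable R : realType.

Lemma JseqE q (s : seq R) : Jseq q s = Jpoly q (size s) (\prod_(x <- s) ('X - x%:P)).
Proof.
rewrite /Jseq JlimE; congr Jpoly; rewrite /row_poly (big_nth 0) big_mkord.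
by apply: eq_bigr => i _; rewrite mxE.
Qed.

Lemma prod_rising_fact N L j : (L <= N)%N ->
  \prod_(i < j) (N%:Z - L%:Z + i.+1%:Z)%:~R = (N - L + j)`!%:R / (N - L)`!%:R :> R.
Proof.
move=> LN; elim: j => [|j IH].
  by rewrite big_ord0 addn0 divff // pnatr_eq0 -lt0n fact_gt0.
rewrite big_ord_recr /= IH addnS factS natrM mulrAC; congr (_ / _).
by rewrite mulrC; congr (_ * _); rewrite subzn // -PoszD addnS.
Qed.

(** The zero roots contribute a power of [X], which only shifts coefficients. The product in [Jpoly]
    starts at [N - L + 1], so it is a quotient of factorials whose denominator [(N - L)!] cancels
    the factor on the left; reversing the index matches the two sums. *)
Lemma Jseq_nonzero_roots N t (s : seq R) : size s = t -> (t <= N)%N ->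
  let nz := [seq x <- s | x != 0] in
  Jseq N%:Z nz * ((N - size nz)`!%:R / (N - t)`!%:R) =
  \sum_(k < t.+1) ((N - k)`!%:R / (N - t)`!%:R) *
    ((-1) ^+ k * (\prod_(x <- s) ('X - x%:P))`_(t - k)).
Proof.
move=> st tN nz; set L := size nz.
have Lt : (L <= t)%N by rewrite -st /L size_filter count_size.
have LN := leq_trans Lt tN.
pose p : {poly R} := \prod_(x <- nz) ('X - x%:P).
have sE : \prod_(x <- s) ('X - x%:P) = 'X^(t - L) * p :> {poly R}.
  rewrite /p big_filter (bigID (fun x => x != 0)) /= mulrC; congr (_ * _).
  rewrite (eq_bigr (fun=> 'X)) => [|x]; last by rewrite negbK => /eqP ->; rewrite subr0.
  rewrite big_const_seq iter_mulr_1; congr (_ ^+ _).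
  by rewrite -st -(count_predC (fun x => x != 0) s) /L size_filter addKn.
rewrite JseqE -/p /Jpoly mulr_suml sE.
transitivity (\sum_(k < L.+1) ((N - k)`!%:R / (N - t)`!%:R) *
    ((-1) ^+ k * p`_(L - k))); last first.
  rewrite (big_ord_widen t.+1 (fun k => (N - k)`!%:R / (N - t)`!%:R *
    ((-1) ^+ k * p`_(L - k)))) //.
  rewrite big_mkcond /=; apply: eq_bigr => k _; rewrite coefXnM ltnS.
  have kt := ltn_ord k; case: (leqP k L) => kL; last first.
    have -> : (t - k < t - L)%N = true by lia.
    by rewrite !mulr0.
  have -> : (t - k < t - L)%N = false by lia.
  by have -> : (t - k - (t - L) = L - k)%N by lia.
rewrite [RHS](reindex_inj rev_ord_inj) /=; apply: eq_bigr => k _.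
have kL : (k <= L)%N by exact: (ltn_ord k).
rewrite subSS prod_rising_fact //.
have -> : (L - (L - k) = k)%N by rewrite subKn.
have -> : (N - (L - k) = N - L + k)%N by lia.
by field; rewrite !pnatr_eq0 -!lt0n !fact_gt0.
Qed.

End JseqFactorials.

(** * Positivity of Gram determinants *)

Section HermitianDeterminants.
Variable R : realType.
Local Notation C := R[i].

Lemma hermE m n (A : 'M[C]_(m, n)) : herm A = (map_mx (@conjc R) A)^T.
Proof. by []. Qed.

(** By Cauchy-Binet, [n!] times the determinant is a sum of squared moduli of minors. *)
Lemma det_herm_mul_ge0 m n (X : 'M[C]_(m, n)) : 0 <= \det (herm X *m X).
Proof.
rewrite -(pmulrn_lge0 _ (fact_gt0 n)) Cauchy_Binet_ffun.
apply: sumr_ge0 => f _.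
have -> : rowsub f (map_mx (@conjc R) X) = map_mx (@conjc R) (rowsub f X).
  by apply/matrixP => a b; rewrite !mxE.
by rewrite det_map_mx mulrC; exact: mulcJ_ge0.
Qed.

Lemma psub_herm_mul m n (X : 'M[C]_(m, n)) (Q : {set 'I_n}) :
  psub (herm X *m X) Q = herm (colsub enum_val X) *m colsub (@enum_val _ (mem Q)) X.
Proof.
apply/matrixP => a b; rewrite !mxE; apply: eq_bigr => i _; rewrite !mxE //.
Qed.

Lemma det_1D_herm_mul m n (c : C) (X : 'M[C]_(m, n)) :
  \det (1%:M + c *: (herm X *m X)) =
  \sum_(Q : {set 'I_n}) c ^+ #|Q| * \det (psub (herm X *m X) Q).
Proof. exact: det_1DZ. Qed.

Lemma det_1D_herm_mul_ge1 m n (c : C) (X : 'M[C]_(m, n)) : 0 <= c ->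
  1 <= \det (1%:M + c *: (herm X *m X)).
Proof.
move=> c0; rewrite det_1D_herm_mul (bigD1 finset.set0) //=.
have -> : \det (psub (herm X *m X) finset.set0) = 1.
  by move: (psub _ _); rewrite cards0 => A; rewrite det_mx00.
rewrite cards0 expr0 mulr1 lerDl; apply: sumr_ge0 => Q _.
by rewrite mulr_ge0 ?exprn_ge0 // psub_herm_mul det_herm_mul_ge0.
Qed.

End HermitianDeterminants.

Section ComplexNoise.
Variable R : realType.
Local Notation C := R[i].

Definition cnoise (q : nat) (s : seq R) : C :=
  (nth 0 s (2 * q) +i* nth 0 s (2 * q + 1)) * rC (Num.sqrt 2)^-1.

Lemma sign_avg_nth n k : (k < n)%N -> sign_avg n (fun s : seq R => (nth 0 s k)%:C) = 0.
Proof.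
elim: n k => [//|n IH] [_|k kn] /=; last by rewrite !IH // addr0 mulr0.
by rewrite !sign_avg_cst rmorphN addrN mulr0.
Qed.

Lemma sign_avg_nth2 n k l : (k < n)%N -> (l < n)%N ->
  sign_avg n (fun s : seq R => (nth 0 s k)%:C * (nth 0 s l)%:C) = (k == l)%:R.
Proof.
move=> kn ln; have [->|kl] := eqVneq k l.
  elim: n l ln {k kn} => [//|n IH] [_|l ln] /=; last by rewrite !IH // -mulr2n mulVf.
  by rewrite !sign_avg_cst rmorphN mulrNN rmorph1 mulr1 mulVf // pnatr_eq0.
rewrite (@sign_avg_indep _ _ _ (pred1 k)) ?sign_avg_nth ?mulr0 //.
  by move=> s s' _ E; rewrite E //= eqxx.
by move=> s s' _ E; rewrite E //= eq_sym.
Qed.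

Let c : C := rC (Num.sqrt 2)^-1.

Let cc : c * c = 2^-1.
Proof.
rewrite /c /rC -rmorphM /= -expr2 exprVn sqr_sqrtr ?ler0n // fmorphV /= rmorph_nat //.
Qed.

Lemma cnoiseE q s :
  cnoise q s = c * (nth 0 s (2 * q))%:C + (c * 'i) * (nth 0 s (2 * q + 1))%:C.
Proof.
rewrite /cnoise [X in X * _]complexE /= mulrDl -/c.
by congr (_ + _); rewrite mulrC ?mulrA.
Qed.

Lemma conj_cnoiseE q s : conjc (cnoise q s) =
  c * (nth 0 s (2 * q))%:C - (c * 'i) * (nth 0 s (2 * q + 1))%:C.
Proof.
rewrite /cnoise /c /rC; apply/eqP; rewrite eq_complex /=.
by apply/andP; split; apply/eqP; ring.
Qed.

Lemma sign_avg_cnoise n q : (2 * q + 1 < n)%N -> sign_avg n (cnoise q) = 0.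
Proof.
move=> qn; rewrite (eq_sign_avg _ (cnoiseE q)).
by rewrite sign_avgD !sign_avgZ !sign_avg_nth ?mulr0 ?addr0 //; lia.
Qed.

Lemma sign_avg_conj_cnoise n q : (2 * q + 1 < n)%N ->
  sign_avg n (fun s => conjc (cnoise q s)) = 0.
Proof.
move=> qn; under eq_fun do rewrite conj_cnoiseE -mulNr.
by rewrite sign_avgD !sign_avgZ !sign_avg_nth ?mulr0 ?addr0 //; lia.
Qed.

Lemma sign_avg_cnoise2 n p q : (2 * p + 1 < n)%N -> (2 * q + 1 < n)%N ->
  sign_avg n (fun s => conjc (cnoise p s) * cnoise q s) = (p == q)%:R.
Proof.
move=> pn qn.
pose x k (s : seq R) : C := (nth 0 s k)%:C.
have E s : conjc (cnoise p s) * cnoise q s =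
   2^-1 * (x (2 * p)%N s * x (2 * q)%N s) +
   (2^-1 * 'i) * (x (2 * p)%N s * x (2 * q + 1)%N s) +
   (- (2^-1 * 'i)) * (x (2 * p + 1)%N s * x (2 * q)%N s) +
   2^-1 * (x (2 * p + 1)%N s * x (2 * q + 1)%N s).
  rewrite conj_cnoiseE cnoiseE -cc -/(x _ _) -/(x _ _) -/(x _ _) -/(x _ _).
  have i2 : 'i * 'i = -1 :> C by rewrite -expr2 sqr_i.
  transitivity (c * c * (x (2 * p)%N s * x (2 * q)%N s) +
   (c * c * 'i) * (x (2 * p)%N s * x (2 * q + 1)%N s) +
   (- (c * c * 'i)) * (x (2 * p + 1)%N s * x (2 * q)%N s) -
   c * c * ('i * 'i) * (x (2 * p + 1)%N s * x (2 * q + 1)%N s)).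
    by ring.
  by rewrite i2; ring.
(* The mixed terms pair an even index with an odd one, so they vanish even when [p = q]; the other
   two contribute one half each. *)
rewrite (eq_sign_avg _ E) !sign_avgD !sign_avgZ !sign_avg_nth2; try lia.
have -> : (2 * p == 2 * q + 1)%N = false by lia.
have -> : (2 * p + 1 == 2 * q)%N = false by lia.
have -> : (2 * p + 1 == 2 * q + 1)%N = (p == q) by lia.
have -> : (2 * p == 2 * q)%N = (p == q) by lia.
by case: (p == q); rewrite ?mulr0 ?addr0 //; field.
Qed.

Lemma depends_on_cnoise (V : pred nat) q : V (2 * q)%N -> V (2 * q + 1)%N ->
  depends_on V (cnoise q).
Proof. by move=> V0 V1 s s' _ E; rewrite /cnoise !E. Qed.

Lemma affine_each_cnoise n q : affine_each (fun x : R => x%:C) n (cnoise q).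
Proof.
have -> : cnoise q = (fun s => c * (nth 0 s (2 * q))%:C + (c * 'i) * (nth 0 s (2 * q + 1))%:C).
  by apply/funext => s; exact: cnoiseE.
by apply: affine_eachD; apply: affine_eachZ; exact: affine_each_nth.
Qed.

End ComplexNoise.

(** * Gram determinants of matrices with independent noisy rows *)

Section NoisyMatrix.
Variables (R : realType) (N T nv : nat) (P : finType).
Local Notation C := R[i].
Variables (idx : 'I_N -> P -> nat) (lab : nat -> nat).
Variables (m : 'M[C]_(N, T)) (K : P -> 'I_T -> C).

(** Row [i] reads its own noise variables [idx i p] through coefficients [K] common to all rows.
    Entries of a row are thus correlated with covariance [noise_cov], while [row_indexing] keeps the
    rows independent. *)
Definition noisy_mx (s : seq R) : 'M[C]_(N, T) :=
  \matrix_(i, b) (m i b + \sum_p K p b * cnoise (idx i p) s).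

Definition noise_cov : 'M[C]_T := \matrix_(a, b) \sum_p conjc (K p a) * K p b.

Definition row_indexing :=
  [/\ forall i, injective (idx i), forall i p, (2 * idx i p + 1 < nv)%N,
      forall i p, lab (2 * idx i p)%N = i & forall i p, lab (2 * idx i p + 1)%N = i].

Hypothesis idxP : row_indexing.

Lemma conj_noisy_mxE s i b : conjc (noisy_mx s i b) =
  conjc (m i b) + \sum_p conjc (K p b) * conjc (cnoise (idx i p) s).
Proof.
rewrite mxE rmorphD /= rmorph_sum /=; congr (_ + _); apply: eq_bigr => p _.
exact: rmorphM.
Qed.

Lemma sign_avg_noisy_mx i a b :
  sign_avg nv (fun s => conjc (noisy_mx s i a) * noisy_mx s i b)
  = noise_cov a b + conjc (m i a) * m i b.
Proof.
have [iinj ilt _ _] := idxP.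
have E s : conjc (noisy_mx s i a) * noisy_mx s i b =
   conjc (m i a) * m i b + \sum_p (conjc (m i a) * K p b) * cnoise (idx i p) s +
   (\sum_p (m i b * conjc (K p a)) * conjc (cnoise (idx i p) s) +
    \sum_p \sum_q (conjc (K p a) * K q b) *
      (conjc (cnoise (idx i p) s) * cnoise (idx i q) s)).
  rewrite conj_noisy_mxE mxE mulrDl mulrDr mulr_sumr; congr (_ + _ + _).
    by apply: eq_bigr => p _; rewrite mulrA.
  rewrite mulrDr mulr_suml; congr (_ + _).
    by apply: eq_bigr => p _; rewrite mulrC mulrA.
  rewrite mulr_suml; apply: eq_bigr => p _; rewrite mulr_sumr; apply: eq_bigr => q _.
  by ring.
rewrite (eq_sign_avg _ E) !sign_avgD sign_avg_cst !sign_avg_sum.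
rewrite [X in _ + X + _]big1 ?addr0; last first.
  by move=> p _; rewrite sign_avgZ sign_avg_cnoise ?mulr0.
rewrite [X in _ + (X + _)]big1 ?add0r; last first.
  by move=> p _; rewrite sign_avgZ sign_avg_conj_cnoise ?mulr0.
rewrite addrC; congr (_ + _); rewrite mxE; apply: eq_bigr => p _.
rewrite sign_avg_sum (bigD1 p) //= sign_avgZ sign_avg_cnoise2 // eqxx mulr1.
rewrite big1 ?addr0 // => q qp; rewrite sign_avgZ sign_avg_cnoise2 //.
by rewrite (inj_eq (iinj i)) eq_sym (negPf qp) mulr0.
Qed.

Lemma depends_on_noisy_mx (i : 'I_N) b :
  depends_on (fun k => lab k == i) (fun s => noisy_mx s i b).
Proof.
have [_ _ l0 l1] := idxP.
move=> s s' ss E; rewrite !mxE; congr (_ + _); apply: eq_bigr => p _; congr (_ * _).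
by apply: (depends_on_cnoise (V := fun k => lab k == i)) ss E; rewrite ?l0 ?l1.
Qed.

Lemma affine_each_noisy_mx i b :
  affine_each (fun x : R => x%:C) nv (fun s => noisy_mx s i b).
Proof.
have -> : (fun s => noisy_mx s i b) =
    (fun s => m i b + \sum_p K p b * cnoise (idx i p) s).
  by apply/funext => s; rewrite mxE.
apply: affine_eachD; first exact: affine_each_cst.
by apply: affine_each_sum => p; apply: affine_eachZ; exact: affine_each_cnoise.
Qed.

Lemma affine_each_conj_noisy_mx i b :
  affine_each (fun x : R => x%:C) nv (fun s => conjc (noisy_mx s i b)).
Proof.
move=> s1 s2 sn; have [x [y E]] := affine_each_noisy_mx i b sn.
exists (conjc x), (conjc y) => z; rewrite E rmorphD /= rmorphM /=.
by congr (_ + _ * _); exact: conjc_real.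
Qed.

Variables (k : nat) (e : 'I_k -> 'I_T).

(** Selections repeating a row have a zero minor. In each remaining product the factors come from
    distinct rows, so its mean factors. *)
Lemma det_gram_noisy_mx s :
  \det (herm (colsub e (noisy_mx s)) *m colsub e (noisy_mx s)) =
  \sum_(f : {ffun 'I_k -> 'I_N} | injectiveb f) \sum_(g : 'S_k) (-1) ^+ g *
     \prod_a (conjc (noisy_mx s (f a) (e a)) * noisy_mx s (f a) (e (g a))).
Proof.
rewrite det_gram (bigID (fun f : {ffun _ -> _} => injectiveb f)) /=.
rewrite [X in _ + X]big1 ?addr0; last first.
  by move=> f Nf; rewrite det_rowsub_noninj ?mulr0.
apply: eq_bigr => f _; rewrite mulr_sumr; apply: eq_bigr => g _.
rewrite mulrCA; congr (_ * _); rewrite -big_split /=.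
by apply: eq_bigr => a _; rewrite !mxE.
Qed.

Let term (f : {ffun 'I_k -> 'I_N}) (g : 'S_k) a s :=
  conjc (noisy_mx s (f a) (e a)) * noisy_mx s (f a) (e (g a)).

Let term_dep (f : {ffun 'I_k -> 'I_N}) g a : depends_on (fun j => lab j == f a) (term f g a).
Proof.
move=> s s' ss E; have H b := @depends_on_noisy_mx (f a) b s s' ss E.
by rewrite /term !H.
Qed.

Let uniq_inj (f : {ffun 'I_k -> 'I_N}) : injectiveb f ->
  uniq [seq nat_of_ord (f a) | a <- index_enum 'I_k].
Proof.
move=> /injectiveP fi; rewrite map_inj_uniq ?index_enum_uniq //.
by move=> a b /val_inj /fi.
Qed.

Lemma quadratic_each_gram_noisy_mx : quadratic_each (fun x : R => x%:C) nv
  (fun s => \det (herm (colsub e (noisy_mx s)) *m colsub e (noisy_mx s))).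
Proof.
rewrite (funext det_gram_noisy_mx).
apply: quadratic_each_sum => f fi; apply: quadratic_each_sum => g _.
apply: quadratic_eachZ.
apply: (@quadratic_each_prod _ _ _ _ lab _ _ _ (term f g)) (uniq_inj fi) _ _ => a.
  exact: term_dep.
by apply: affine_eachM; [exact: affine_each_conj_noisy_mx|exact: affine_each_noisy_mx].
Qed.

Lemma sign_avg_gram_noisy_mx :
  sign_avg nv (fun s => \det (herm (colsub e (noisy_mx s)) *m colsub e (noisy_mx s)))
  = \sum_(f : {ffun 'I_k -> 'I_N} | injectiveb f)
      \det (\matrix_(a, b) (noise_cov (e a) (e b) +
                            conjc (m (f a) (e a)) * m (f a) (e b))).
Proof.
rewrite (funext det_gram_noisy_mx).
rewrite sign_avg_sum; apply: eq_bigr => f fi.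
rewrite sign_avg_sum; apply: eq_bigr => g _; rewrite sign_avgZ; congr (_ * _).
rewrite (@sign_avg_prod _ _ _ lab _ _ _ (term f g) (uniq_inj fi)); last exact: term_dep.
by apply: eq_bigr => a _; rewrite sign_avg_noisy_mx !mxE.
Qed.

End NoisyMatrix.

(** * The mean of the determinant of a noisy matrix *)

Section ExpectedDeterminant.
Variable R : realType.
Local Notation C := R[i].

Lemma sum_by_card (V : nmodType) n (F : {set 'I_n} -> V) :
  \sum_U F U = \sum_(k < n.+1) \sum_(U : {set 'I_n} | #|U| == k) F U.
Proof.
rewrite (partition_big (fun U : {set 'I_n} => inord #|U| : 'I_n.+1) predT) //=.
apply: eq_bigr => k _; apply: eq_bigl => U; rewrite -val_eqE /= inordK //.
by rewrite ltnS -[X in (_ <= X)%N]card_ord max_card.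
Qed.

Lemma Re_sign_avg n (F : seq R -> C) :
  sign_avg n (fun s => complex.Re (F s)) = complex.Re (sign_avg n F).
Proof.
elim: n F => [|n IH] F //=; rewrite !IH.
have -> : (2^-1 : C) = (2^-1 : R)%:C by rewrite fmorphV rmorph_nat.
by case: (sign_avg n _) => a b; case: (sign_avg n _) => a' b' /=; rewrite mul0r subr0.
Qed.

Lemma quadratic_each_Re n (F : seq R -> C) : quadratic_each (fun x : R => x%:C) n F ->
  quadratic_each id n (fun s => complex.Re (F s)).
Proof.
move=> Q s1 s2 sn; have [a [b [c E]]] := Q _ _ sn.
exists (complex.Re a), (complex.Re b), (complex.Re c) => x; rewrite E.
by case: a b c {E} => a a' [b b'] [c c'] /=; ring.
Qed.

Lemma det_1D_mul_herm m n (c : C) (X : 'M[C]_(m, n)) :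
  \det (1%:M + c *: (X *m herm X)) = \det (1%:M + c *: (herm X *m X)).
Proof. by rewrite scalemxAl det_1Dmul_comm scalemxAr. Qed.

Lemma map_poly_prod_XsubC (s : seq R) :
  \prod_(x <- s) ('X - (rC x)%:P) = map_poly (real_complex R) (\prod_(x <- s) ('X - x%:P)).
Proof.
rewrite rmorph_prod; apply: eq_bigr => x _.
by rewrite rmorphB /= map_polyX map_polyC.
Qed.

Lemma sum_inj_det_eigen N k (Psi : 'M[C]_k) (m : 'M[C]_(N, k)) (s : seq R) :
  (k <= N)%N -> Psi \in unitmx -> \det Psi \is Num.real ->
  char_poly (invmx Psi *m (herm m *m m)) = \prod_(x <- s) ('X - (rC x)%:P) ->
  let nz := [seq x <- s | x != 0] in
  \sum_(f : {ffun 'I_k -> 'I_N} | injectiveb f)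
     \det (\matrix_(a, b) (Psi a b + conjc (m (f a) a) * m (f a) b))
  = rC (complex.Re (\det Psi) * Jseq N%:Z nz *
        ((N - size nz)`!%:R / (N - k)`!%:R)).
Proof.
move=> kN uPsi rPsi chi nz.
have sk : size s = k.
  apply/succn_inj; rewrite -(size_char_poly (invmx Psi *m (herm m *m m))) chi.
  by rewrite size_prod_XsubC.
have -> : \sum_(f : {ffun 'I_k -> 'I_N} | injectiveb f)
     \det (\matrix_(a, b) (Psi a b + conjc (m (f a) a) * m (f a) b)) =
   \sum_(f : {ffun 'I_k -> 'I_N} | injectiveb f)
     \det (\matrix_(a, b) (Psi a b + map_mx (@conjc R) m (f a) a * m (f a) b)).
  apply: eq_bigr => f _; congr (\det _); apply/matrixP => a b; rewrite !mxE //.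
rewrite sum_inj_det_rank1 // -hermE sum_by_card.
transitivity (\sum_(j < k.+1) ((N - j)`!%:R / (N - k)`!%:R) * (\det Psi *
    ((-1) ^+ j * (rC (\prod_(x <- s) ('X - x%:P))`_(k - j))))).
  apply: eq_bigr => j _.
  have -> : rC (\prod_(x <- s) ('X - x%:P))`_(k - j) =
     (char_poly (invmx Psi *m (herm m *m m)))`_(k - j).
    by rewrite chi map_poly_prod_XsubC coef_map.
  rewrite -char_poly_mix_rows //; last by rewrite -ltnS.
  by rewrite mulr_sumr; apply: eq_bigr => U /eqP ->.
rewrite -mulrA (Jseq_nonzero_roots sk kN) /rC mulr_sumr rmorph_sum /=.
apply: eq_bigr => j _; rewrite -[\det Psi in LHS]RRe_real //.
rewrite !rmorphM /= fmorphV /= !rmorph_nat rmorphXn /= rmorphN rmorph1.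
by rewrite mulrCA.
Qed.

Lemma sum_inj_ffun0 k N (F : {ffun 'I_k -> 'I_N} -> C) : (N < k)%N ->
  \sum_(f : {ffun 'I_k -> 'I_N} | injectiveb f) F f = 0.
Proof.
move=> Nk; rewrite big_pred0 // => f; apply/negP => /injectiveP /leq_card.
by rewrite !card_ord leqNgt Nk.
Qed.

Lemma det_noisy_mxE N T (P : finType) (idx : 'I_N -> P -> nat)
    (m : 'M[C]_(N, T)) (K : P -> 'I_T -> C) (c : C) s :
  \det (1%:M + c *: (noisy_mx idx m K s *m herm (noisy_mx idx m K s))) =
  \sum_(Q : {set 'I_T}) c ^+ #|Q| *
    \det (herm (colsub (@enum_val _ (mem Q)) (noisy_mx idx m K s)) *m
          colsub (@enum_val _ (mem Q)) (noisy_mx idx m K s)).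
Proof.
rewrite det_1D_mul_herm det_1D_herm_mul; apply: eq_bigr => Q _.
by rewrite psub_herm_mul.
Qed.

Lemma quadratic_each_det_noisy_mx N T nv (P : finType) (idx : 'I_N -> P -> nat)
    (lab : nat -> nat) (m : 'M[C]_(N, T)) (K : P -> 'I_T -> C) (c : C) :
  row_indexing nv idx lab -> quadratic_each (fun x : R => x%:C) nv
   (fun s => \det (1%:M + c *: (noisy_mx idx m K s *m herm (noisy_mx idx m K s)))).
Proof.
move=> idxP; rewrite (funext (det_noisy_mxE idx m K c)).
apply: quadratic_each_sum => Q _; apply: quadratic_eachZ.
exact: quadratic_each_gram_noisy_mx idxP _ _.
Qed.

Lemma sign_avg_det_noisy_mx N T nv (P : finType) (idx : 'I_N -> P -> nat)
    (lab : nat -> nat) (m : 'M[C]_(N, T)) (K : P -> 'I_T -> C) (r : R)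
    (eig : {set 'I_T} -> seq R) :
  row_indexing nv idx lab -> (N <= T)%N ->
  (forall Q, 0 < \det (psub (noise_cov K) Q)) ->
  (forall Q, char_poly (invmx (psub (noise_cov K) Q) *m psub (herm m *m m) Q)
     = \prod_(x <- eig Q) ('X - (rC x)%:P)) ->
  let nz Q := [seq x <- eig Q | x != 0] in
  sign_avg nv (fun s => \det (1%:M + rC r *: (noisy_mx idx m K s *m herm (noisy_mx idx m K s))))
  = rC (\sum_(t < N.+1) r ^+ t * \sum_(Q : {set 'I_T} | #|Q| == t)
       complex.Re (\det (psub (noise_cov K) Q)) * Jseq N%:Z (nz Q) *
       ((N - size (nz Q))`!%:R / (N - t)`!%:R)).
Proof.
move=> idxP NT Psi0 chi nz.
rewrite (funext (det_noisy_mxE idx m K (rC r))) sign_avg_sum sum_by_card.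
pose S t := \sum_(Q : {set 'I_T} | #|Q| == t) sign_avg nv (fun s => rC r ^+ #|Q| *
    \det (herm (colsub (@enum_val _ (mem Q)) (noisy_mx idx m K s)) *m
          colsub (@enum_val _ (mem Q)) (noisy_mx idx m K s))).
have SE (Q : {set 'I_T}) := sign_avg_gram_noisy_mx m K idxP (@enum_val _ (mem Q)).
(* A set [Q] with more than [N] elements has no injection into the rows, so its Gram determinant has
   mean 0. *)
have -> : \sum_(t < T.+1) S t = \sum_(t < N.+1) S t.
  rewrite [RHS](big_ord_widen T.+1 S) ?ltnS // [RHS]big_mkcond /=.
  apply: eq_bigr => t _; case: ltnP => // Nt.
  rewrite /S big1 // => Q /eqP Qt; rewrite sign_avgZ SE sum_inj_ffun0 ?mulr0 //.
  by rewrite Qt.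
rewrite /rC rmorph_sum; apply: eq_bigr => t _; rewrite /S rmorphM rmorphXn /= rmorph_sum.
rewrite mulr_sumr; apply: eq_bigr => Q /eqP Qt; rewrite sign_avgZ -Qt; congr (_ * _).
rewrite SE -[RHS]/(rC _).
rewrite -(@sum_inj_det_eigen N _ _ (colsub (@enum_val _ (mem Q)) m) (eig Q)).
- by apply: eq_bigr => f _; congr (\det _); apply/matrixP => a b; rewrite !mxE.
- by have := ltn_ord t; rewrite ltnS -Qt.
- by rewrite unitmxE unitfE (gt_eqF (Psi0 Q)).
- exact: gtr0_real (Psi0 Q).
- by rewrite -psub_herm_mul; exact: chi.
Qed.

End ExpectedDeterminant.

(** * The channel as a noisy matrix *)

Lemma noise_index_inj M n k l (p q : 'I_M + 'I_n) :
  match p with inl a => (k * M + a)%N | inr b => (l * M + (k * n + b))%N end =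
  match q with inl a => (k * M + a)%N | inr b => (l * M + (k * n + b))%N end ->
  (k < l)%N -> p = q.
Proof.
move=> E kl; have kM : (k.+1 * M <= l * M)%N by rewrite leq_mul2r kl orbT.
case: p q E => [a|b] [a'|b'] E.
- by congr inl; apply/val_inj/(addnI E).
- by have := ltn_ord a; rewrite mulSn in kM; lia.
- by have := ltn_ord a'; rewrite mulSn in kM; lia.
- by congr inr; apply/val_inj; move/addnI/addnI: E.
Qed.

Section ChannelIndexing.
Variables (Nr M Nt : nat).

(** Numbering of the complex noise variables as read by [cgauss_mx]: those of the first factor row
    by row, then those of the direct link from offset [Nr * M]. [channel_row] recovers the row from
    the index of a real coordinate, two of which make one complex variable. *)
Definition channel_idx (i : 'I_Nr) (p : 'I_M + 'I_Nt) : nat :=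
  match p with inl a => (i * M + a)%N | inr b => (Nr * M + (i * Nt + b))%N end.

Definition channel_row (k : nat) : nat :=
  if (k < 2 * (Nr * M))%N then (k %/ (2 * M))%N
  else ((k - 2 * (Nr * M)) %/ (2 * Nt))%N.

Lemma divn_pair_index i n (a : 'I_n) e : (e < 2)%N ->
  ((2 * (i * n + a) + e) %/ (2 * n) = i)%N.
Proof.
move=> e2; have an := ltn_ord a.
have -> : (2 * (i * n + a) + e = i * (2 * n) + (2 * a + e))%N by ring.
rewrite divnMDl ?divn_small ?addn0 //; lia.
Qed.

Lemma channel_row_idx i p e : (e < 2)%N -> channel_row (2 * channel_idx i p + e) = i.
Proof.
move=> e2; rewrite /channel_row /channel_idx; case: p => [a|b].
  have aM := ltn_ord a.
  have iM : (i.+1 * M <= Nr * M)%N by rewrite leq_mul2r ltn_ord orbT.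
  have -> : (2 * (i * M + a) + e < 2 * (Nr * M))%N = true.
    by rewrite mulSn in iM; lia.
  exact: divn_pair_index.
have -> : (2 * (Nr * M + (i * Nt + b)) + e < 2 * (Nr * M))%N = false by lia.
have -> : (2 * (Nr * M + (i * Nt + b)) + e - 2 * (Nr * M) = 2 * (i * Nt + b) + e)%N by lia.
exact: divn_pair_index.
Qed.

Lemma channel_row_indexing :
  row_indexing (2 * (Nr * M + Nr * Nt)) channel_idx channel_row.
Proof.
split=> [i p q E|i p|i p|i p].
- exact: (noise_index_inj E (ltn_ord i)).
- have iM : (i.+1 * M <= Nr * M)%N by rewrite leq_mul2r ltn_ord orbT.
  have iN : (i.+1 * Nt <= Nr * Nt)%N by rewrite leq_mul2r ltn_ord orbT.
  rewrite !mulSn in iM iN.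
  by case: p => [a|b] /=; [have := ltn_ord a|have := ltn_ord b]; lia.
- by rewrite -[X in channel_row X]addn0 channel_row_idx.
- exact: channel_row_idx.
Qed.

End ChannelIndexing.

(** Factoring out [b > 0] leaves the identity plus a nonnegative multiple of a Gram matrix, whose
    determinant is at least 1. *)
Lemma psub_scalar_gram_det_gt0 (R : realType) m n (W : 'M[R[i]]_(m, n)) (d b : R)
    (Q : {set 'I_n}) : 0 <= d -> 0 < b ->
  0 < \det (psub (rC d *: (herm W *m W) + rC b *: 1%:M) Q).
Proof.
move=> d0 b0.
have bC : 0 < rC b by rewrite ltcE /= eqxx.
have -> : psub (rC d *: (herm W *m W) + rC b *: 1%:M) Q =
   rC b *: (1%:M + (rC d / rC b) *: (herm (colsub (@enum_val _ (mem Q)) W) *m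
                                     colsub (@enum_val _ (mem Q)) W)).
  rewrite -psub_herm_mul scalerDr scalerA mulrCA divff ?gt_eqF // mulr1 addrC.
  by apply/matrixP => i j; rewrite !mxE (inj_eq enum_val_inj).
rewrite detZ mulr_gt0 ?exprn_gt0 //; apply: lt_le_trans ltr01 _.
by apply: det_1D_herm_mul_ge1; rewrite divr_ge0 ?(ltW bC) // lecE /= eqxx.
Qed.

Lemma conjcM (R : realType) : {morph (@conjc R) : x y / x * y}.
Proof. exact: rmorphM. Qed.

Lemma conj_cexpjK (R : realType) (x : R) : conjc (cexpj x) * cexpj x = 1.
Proof.
apply/eqP; rewrite eq_complex /= mulNr opprK -!expr2 cos2Dsin2 eqxx /=.
by rewrite mulrC mulNr subrr.
Qed.

Lemma rC_sqrtM (R : realType) (x y : R) : 0 <= x ->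
  rC (Num.sqrt x) * rC (Num.sqrt y) = rC (Num.sqrt (x * y)).
Proof. by move=> x0; rewrite sqrtrM // /rC rmorphM. Qed.

Lemma conj_rC_sqrtK (R : realType) (x : R) : 0 <= x ->
  conjc (rC (Num.sqrt x)) * rC (Num.sqrt x) = rC x.
Proof.
by move=> x0; rewrite /rC conjc_real -rmorphM /= -expr2 sqr_sqrtr.
Qed.

Lemma cgauss_mxE (R : realType) m n q (s : seq R) i j :
  cgauss_mx m n (2 * q) s i j = cnoise (q + (i * n + j)) s.
Proof. by rewrite mxE /cnoise -mulnDr. Qed.

Theorem theorem2 (R : realType)
  (Nt Nr Mh Mv PT PR PH : nat)
  (dt dr dh dv lam : R)
  (tg : 'I_PT -> R[i]) (phia1 tha1 thd1 : 'I_PT -> R)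
  (rg : 'I_PR -> R[i]) (tha2 phid2 thd2 : 'I_PR -> R)
  (hg : 'I_PH -> R[i]) (tha3 thd3 : 'I_PH -> R)
  (phases : 'I_(Mh * Mv) -> R)
  (bt br bd LR NR LH NH rho : R)
  (eig : {set 'I_Nt} -> seq R) :
  (0 < Nr)%N -> (0 < Mh)%N -> (0 < Mv)%N ->
  (0 < PT)%N -> (0 < PR)%N -> (0 < PH)%N ->
  (Nr < Nt)%N ->
  0 < lam ->
  0 < bt -> 0 < br -> 0 < bd ->
  0 <= LR -> 0 <= NR -> LR + NR = 1 ->
  0 <= LH -> 0 < NH -> LH + NH = 1 ->
  0 < rho ->
  let M := (Mh * Mv)%N in
  let T : 'M[R[i]]_(M, Nt) := Tmat Nt Mh Mv dt dh dv lam tg phia1 tha1 thd1 in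
  let Rbar : 'M[R[i]]_(Nr, M) := Rbarmat Nr Mh Mv dr dh dv lam rg tha2 phid2 thd2 in
  let Hbar : 'M[R[i]]_(Nr, Nt) := Hbarmat Nr Nt dr dt lam hg tha3 thd3 in
  let Phi : 'M[R[i]]_M := Phimat phases in
  let rhob : R := rho / Nt%:R in
  (* the random channel, as a function of the 2(Nr*M + Nr*Nt) i.i.d. N(0,1) reals s *)
  let Rtil (s : seq R) : 'M[R[i]]_(Nr, M) := cgauss_mx Nr M 0 s in
  let Htil (s : seq R) : 'M[R[i]]_(Nr, Nt) := cgauss_mx Nr Nt (2 * (Nr * M)) s in
  let Rm s := rC (Num.sqrt LR) *: Rbar + rC (Num.sqrt NR) *: Rtil s in
  let Hm s := rC (Num.sqrt LH) *: Hbar + rC (Num.sqrt NH) *: Htil s in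
  let G s := rC (Num.sqrt (bt * br)) *: (Rm s *m Phi *m T) + rC (Num.sqrt bd) *: Hm s in
  let C : \bar R :=
    gauss_expect (2 * (Nr * M + Nr * Nt))
      (fun s => (log2 (complex.Re (\det (1%:M + rC rhob *: (G s *m herm (G s))))))%:E) in
  let Gbar := rC (Num.sqrt (bt * br * LR)) *: (Rbar *m Phi *m T)
              + rC (Num.sqrt (bd * LH)) *: Hbar in
  let Psi : 'M[R[i]]_Nt := rC (bt * br * NR) *: (herm T *m T) + rC (bd * NH) *: 1%:M in
  let Sigma : 'M[R[i]]_Nt := herm Gbar *m Gbar in
  (* eig Q : the eigenvalues (with multiplicity; they are real) of Psi_Q^{-1} Sigma_Q *)
  (forall Q : {set 'I_Nt},
      char_poly (invmx (psub Psi Q) *m psub Sigma Q)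
      = \prod_(x <- eig Q) ('X - (rC x)%:P)) ->
  let nzeig (Q : {set 'I_Nt}) := [seq x <- eig Q | x != 0] in
  (C <= (log2 (\sum_(t < Nr.+1) rhob ^+ t *
        \sum_(Q : {set 'I_Nt} | #|Q| == t)
           complex.Re (\det (psub Psi Q)) * Jseq Nr%:Z (nzeig Q)
           * (((Nr - size (nzeig Q))`!)%N%:R / ((Nr - t)`!)%N%:R)))%:E)%E.
Proof.
move=> _ _ _ _ _ _ NrNt _ bt0 br0 bd0 LR0 NR0 _ LH0 NH0 _ rho0.
move=> M T Rbar Hbar Phi rhob Rtil Htil Rm Hm G C Gbar Psi Sigma chi; cbv zeta.
have bt0' := ltW bt0; have bd0' := ltW bd0.
have btr0 : 0 <= bt * br by rewrite mulr_ge0 ?ltW.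
have rhob0 : 0 <= rC rhob by rewrite /rC ler0c divr_ge0 ?ler0n ?ltW.
(* Noise of the reflected link reaches column [b] through the rows of [Phi *m T]; noise of the
   direct link reaches only its own column. *)
pose K (p : 'I_M + 'I_Nt) (b : 'I_Nt) : R[i] :=
  match p with
  | inl a => rC (Num.sqrt (bt * br * NR)) * (Phi *m T) a b
  | inr j => rC (Num.sqrt (bd * NH)) * (j == b)%:R
  end.
have GE : G = noisy_mx (@channel_idx Nr M Nt) Gbar K.
  apply/funext => s.
  have -> : G s = Gbar + (rC (Num.sqrt (bt * br * NR)) *: (Rtil s *m (Phi *m T)) +
                          rC (Num.sqrt (bd * NH)) *: Htil s).
    rewrite /G /Rm /Hm /Gbar -!rC_sqrtM // !mulmxDl -!scalemxAl !mulmxA.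
    by rewrite !scalerDr !scalerA addrACA.
  apply/matrixP => i b; rewrite [RHS]mxE big_sumType /=.
  have -> : \sum_(a < M) rC (Num.sqrt (bt * br * NR)) * (Phi *m T) a b *
              cnoise (i * M + a) s
          = rC (Num.sqrt (bt * br * NR)) * (Rtil s *m (Phi *m T)) i b.
    rewrite [in RHS]mxE mulr_sumr; apply: eq_bigr => a _.
    by rewrite (cgauss_mxE 0) add0n -mulrA [cnoise _ _ * _]mulrC.
  have -> : \sum_(j < Nt) rC (Num.sqrt (bd * NH)) * (j == b)%:R *
              cnoise (Nr * M + (i * Nt + j)) s
          = rC (Num.sqrt (bd * NH)) * Htil s i b.
    rewrite (bigD1 b) //= eqxx mulr1 cgauss_mxE big1 ?addr0 // => j /negPf ->.
    by rewrite mulr0 mul0r.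
  by rewrite mxE; congr (_ + _); rewrite mxE; congr (_ + _); rewrite mxE.
have PsiE : noise_cov K = Psi.
  (* [Phi] multiplies row [a] of [T] by a number of modulus 1, which cancels against its conjugate
     in the covariance. *)
  have PhiTE a b : (Phi *m T) a b = cexpj (phases a) * T a b.
    by rewrite /Phi /Phimat mul_diag_mx mxE [X in X * _]mxE.
  apply/matrixP => a b; rewrite mxE big_sumType /= [RHS]mxE; congr (_ + _).
    rewrite !mxE mulr_sumr; apply: eq_bigr => j _; rewrite !PhiTE !mxE.
    rewrite !conjcM -(conj_rC_sqrtK (mulr_ge0 btr0 NR0)).
    rewrite -[conjc (T j a) * T j b]mul1r -(conj_cexpjK (phases j)).
    by rewrite mulrACA; congr (_ * _); rewrite mulrACA.
  rewrite !mxE (bigD1 a) //= eqxx big1 ?addr0 => [|j /negPf ja]; last first.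
    by rewrite conjcM ja conjc_nat mulr0 mul0r.
  by rewrite mulr1 mulrA conj_rC_sqrtK // mulr_ge0 // ltW.
have QF := quadratic_each_Re (quadratic_each_det_noisy_mx Gbar K (rC rhob)
  (channel_row_indexing Nr M Nt)).
have det0 Q : 0 < \det (psub (noise_cov K) Q).
  rewrite PsiE; apply: psub_scalar_gram_det_gt0; first exact: mulr_ge0.
  exact: mulr_gt0.
have avg := sign_avg_det_noisy_mx rhob (channel_row_indexing Nr M Nt) (ltnW NrNt) det0.
rewrite PsiE in avg; have {}avg := avg Gbar eig chi.
rewrite /C GE.
apply: le_trans (gauss_expect_log2 QF _) _ => [s|].
  have := det_1D_herm_mul_ge1 (noisy_mx (@channel_idx Nr M Nt) Gbar K s) rhob0.
  by rewrite -det_1D_mul_herm lecE => /andP [].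
by rewrite Re_sign_avg avg.
Qed.
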